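(* Let $T>0$, $\theta\in[0,1]$, $k\in\mathbb N$, $U_0\in\mathscr F^{sa}$ and $\alpha,\beta^i,\gamma^i:\mathscr F^{sa}\to\mathscr F^{sa}$ ($i=1,\dots,k$). Suppose that the free SDE $$\mathrm dU_t=\alpha(U_t)\,\mathrm dt+\sum_{i=1}^k\beta^i(U_t)\,\mathrm dW_t\,\gamma^i(U_t)$$ with initial value $U_0$ has a unique solution $\{U_t\}_{t\in[0,T]}$, that $\sup_{t\in[0,T]}\|U_t\|<\infty$, and that for the step sizes $h=T/P$ ($P\in\mathbb N$) under consideration the free stochastic theta scheme $$\bar U_{n+1}=\bar U_n+(1-\theta)\alpha(\bar U_n)h+\theta\alpha(\bar U_{n+1})h+\sum_{i=1}^k\beta^i(\bar U_n)\,\Delta W_n\,\gamma^i(\bar U_n),\qquad n=0,\dots,P-1,\quad \bar U_0=U_0,$$ has a unique solution $\{\bar U_n\}_{n=0,\dots,P}\subset\mathscr F^{sa}$ which is adapted to $\{\mathscr W_{t_n}\}_{n=0,\dots,P}$. Suppose moreover that $\alpha$ is operator Lipschitz in the $L^2(\psi)$ norm and that all $\beta^i,\gamma^i$ are locally operator Lipschitz in the $L^2(\psi)$ norm. Then there exists a constant $A'>0$, independent of $h$, such that $\sup_{0\le n\le P}\|\bar U_n\|_2^2\le A'$ whenever the step size $h$ is sufficiently small. Moreover, the scheme converges strongly with order $1/2$: there exists a constant $C>0$ independent of $h$ such that, for all sufficiently small $h$ and all $n=0,1,\dots,P$, $$\|U_{t_n}-\bar U_n\|_2\le C\,h^{1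/2}.$$
   Context: $(\mathscr F,\psi)$ is a non-commutative probability space: a von Neumann algebra $\mathscr F$ with a faithful unital normal trace $\psi$. $\mathscr F^{sa}$ is the set of self-adjoint elements, $\|\cdot\|$ the operator norm, $\|U\|_2=\psi(|U|^2)^{1/2}$ with $|U|=(U^*U)^{1/2}$. $\{W_t\}_{t\ge0}\subset\mathscr F^{sa}$ is a free Brownian motion: $W_0=0$; for $0\le s<t$ the increment $W_t-W_s$ is freely independent from $\mathscr W_s$, the von Neumann algebra generated by $\{W_\tau:0\le\tau\le s\}$; and $W_t-W_s$ has the semicircular distribution of mean $0$ and variance $t-s$. A process $U_t$ is adapted if $U_t\in\mathscr W_t$ for all $t$ (similarly, $\bar U_n\in\mathscr W_{t_n}$ for all $n$). For $\beta_t,\gamma_t\in\mathscr W_t$ with $\|\beta_t\|\|\gamma_t\|\in L^2([0,T])$, the free stochastic integral $\int_0^T\beta_t\,\mathrm dW_t\,\gamma_t$ is the operator-norm limit of $\sum_i\beta_{t_{i-1}}(W_{t_i}-W_{t_{i-1}})\gamma_{t_{i-1}}$ as the mesh of the partition tends to $0$. Convention on coefficients: $\alpha,\beta^i,\gamma^i$ map $\mathscr F^{sa}\cap\mathscr W_t$ into $\mathscr W_t$ for every $t$, and the noise sums $\sum_i\beta^i(\bar U_n)\Delta W_n\gamma^i(\bar U_n)$ are self-adjoint. A solution of the free SDE on $[0,T]$ is an adapted family $\{U_t\}_{0\le t\le T}\subset\mathscr F^{sa}$ with $\|\alpha(U_t)\|\in L^1([0,T])$, $\|\beta^i(U_t)\|\|\gamma^i(U_t)\|\in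 L^2([0,T])$ and $U_t=U_0+\int_0^t\alpha(U_s)\,\mathrm ds+\sum_{i=1}^k\int_0^t\beta^i(U_s)\,\mathrm dW_s\,\gamma^i(U_s)$ for all $t\in[0,T]$. For $P\in\mathbb N$: $h=T/P$, $t_n=nh$, $\Delta W_n=W_{t_{n+1}}-W_{t_n}$. A map $f:\mathscr F^{sa}\to\mathscr F^{sa}$ is operator Lipschitz in the $L^2(\psi)$ norm if there is $L_f>0$ with $\|f(U)-f(V)\|_2\le L_f\|U-V\|_2$ for all $U,V\in\mathscr F^{sa}$. It is locally operator Lipschitz in the $L^2(\psi)$ norm if for every $M>0$ there is $L_f(M)>0$ with $\|f(U)-f(V)\|_2\le L_f(M)\|U-V\|_2$ for all $U,V\in\mathscr F^{sa}$ with $\|U\|_2,\|V\|_2\le M$. *)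

(* Defs.v *)
From HB Require Import structures.
From mathcomp Require Import all_boot all_order all_algebra sesquilinear.
From mathcomp Require Import complex.
From mathcomp Require Import all_classical all_reals all_analysis.
Set Implicit Arguments.
Unset Strict Implicit.
Unset Printing Implicit Defensive.
Import Order.TTheory GRing.Theory Num.Theory.
Import numFieldNormedType.Exports.
Local Open Scope classical_set_scope.
Local Open Scope complex_scope.
Local Open Scope ring_scope.

(* The inner product is linear in its first argument. *)
Record hilbertSpace (R : realType) := HilbertSpace {
  hilbert_sort :> completeNormedModType R[i] ;
  ip : {dot hilbert_sort for @Num.conj R[i]} ;
  ip_norm : forall x : hilbert_sort, `|x| ^+ 2 = ip x x }.

Section Operators.
Context {R : realType} {H : hilbertSpace R}.
Local Notation op := (H -> H).
Implicit Types (A B S : set op) (T U V X : op).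

Definition bounded_linear T :=
  linear T /\ exists M : R, forall x : H, `|T x| <= M%:C * `|x|.

(* Norms in H take values in R[i], hence the real part. *)
Definition opnorm T : R :=
  sup [set complex.Re `|T x| | x in [set x : H | `|x| <= 1]].

Definition is_adjoint T U := forall x y : H, ip H (T x) y = ip H x (U y).

Definition adj T : op := xget 0 [set U | is_adjoint T U].

Definition selfadjoint T := is_adjoint T T.

Definition op_le U V := forall x : H, 0 <= ip H (V x - U x) x.

Definition wot_closure A : set op := [set T | bounded_linear T /\
  forall (s : seq (H * H)) (e : R), 0 < e ->
    exists2 U, A U & forall i, (i < size s)%N ->
      let p := nth (0, 0) s i in `|ip H (T p.1 - U p.1) p.2| < e%:C].

Record von_neumann A : Prop := VonNeumann {
  vn_bounded : A `<=` bounded_linear ;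
  vn_one : A idfun ;
  vn_linear : forall (c : R[i]) U V, A U -> A V -> A (c *: U + V) ;
  vn_mul : forall U V, A U -> A V -> A (U \o V) ;
  vn_adj : forall U, A U -> exists2 V, A V & is_adjoint U V ;
  vn_closed : wot_closure A `<=` A }.

Definition vn_gen S : set op :=
  [set T | forall A, von_neumann A -> S `<=` A -> A T].

Definition poly_op (p : {poly R[i]}) X : op :=
  \sum_(j < size p) p`_j *: iter j X.

Definition alg_gen X : set op := [set poly_op p X | p in setT].

Definition op_mul U V : op := U \o V.

Section Trace.
Variables (F : set op) (psi : op -> R[i]).

Record tracial_state : Prop := TracialState {
  ts_linear : forall (c : R[i]) U V, F U -> F V ->
    psi (c *: U + V) = c * psi U + psi V ;
  ts_one : psi idfun = 1 ;
  ts_pos : forall U V, F U -> F V -> is_adjoint U V -> 0 <= psi (V \o U) ;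
  ts_trace : forall U V, F U -> F V -> psi (U \o V) = psi (V \o U) }.

Definition faithful := forall U V, F U -> F V -> is_adjoint U V ->
  psi (V \o U) = 0 -> U = 0.

(* Upward directed sets of self-adjoint elements play the role of bounded
   increasing nets; X is the least upper bound of D. *)
Definition normal_state := forall (D : set op) X,
  D !=set0 ->
  (forall U, D U -> F U /\ selfadjoint U) ->
  (forall U V, D U -> D V -> exists2 Y, D Y & op_le U Y /\ op_le V Y) ->
  F X -> selfadjoint X ->
  (forall U, D U -> op_le U X) ->
  (forall Y, F Y -> selfadjoint Y -> (forall U, D U -> op_le U Y) ->
     op_le X Y) ->
  complex.Re (psi X) = sup [set complex.Re (psi U) | U in D].

End Trace.
End Operators.

Record ncProbSpace (R : realType) := NCProbSpace {
  nc_hilbert :> hilbertSpace R ;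
  vna : set (nc_hilbert -> nc_hilbert) ;
  vna_von_neumann : von_neumann vna ;
  psi : (nc_hilbert -> nc_hilbert) -> R[i] ;
  psi_tracial : tracial_state vna psi ;
  psi_faithful : faithful vna psi ;
  psi_normal : normal_state vna psi }.

Arguments vna {R} _.
Arguments psi {R} _.

Section FreeProbability.
Context {R : realType} {F : ncProbSpace R}.
Local Notation op := (F -> F).
Local Notation mu := (@lebesgue_measure R).
Implicit Types (A B : set op) (U V X : op).

Definition vna_sa : set op := [set U | vna F U /\ selfadjoint U].

(* |U|^2 is U^* U, since |U| is the square root of U^* U. *)
Definition norm2 U : R := Num.sqrt (complex.Re (psi F (adj U \o U))).

(* A and B are meant to be unital subalgebras.
   Words alternate between A and B, starting with A iff b is true. *)
Definition free_sets A B := forall (n : nat) (b : bool) (a : 'I_n.+1 -> op),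
  (forall j, psi F (a j) = 0) ->
  (forall j : 'I_n.+1, if odd j (+) b then A (a j) else B (a j)) ->
  psi F (\big[@op_mul R F/idfun]_(j < n.+1) a j) = 0.

Definition semicircle_density (v x : R) : R :=
  Num.sqrt (4 * v - x ^+ 2) / (2 * pi * v).

(* A bounded self-adjoint element has as its distribution the compactly
   supported probability measure with the same moments. *)
Definition semicircular (v : R) X := forall m : nat,
  psi F (iter m X) =
  (\int[mu]_(x in `[- (2 * Num.sqrt v), 2 * Num.sqrt v])
     (x ^+ m * semicircle_density v x))%:C.

Definition filtration (W : R -> op) (t : R) : set op :=
  vn_gen [set W s | s in `[0, t]].

Record free_brownian (W : R -> op) : Prop := FreeBrownian {
  fbm_sa : forall t, 0 <= t -> vna_sa (W t) ;
  fbm0 : W 0 = 0 ;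
  fbm_free : forall s t, 0 <= s -> s < t ->
    free_sets (alg_gen (W t - W s)) (filtration W s) ;
  fbm_law : forall s t, 0 <= s -> s < t -> semicircular (t - s) (W t - W s) }.

(* f is only required to be almost everywhere equal to a Borel function. *)
Definition in_Lp (p : nat) (T : R) (f : R -> R) := exists2 g : R -> R,
  measurable_fun `[0, T] g /\ {ae mu, forall x, x \in `[0, T] -> f x = g x} &
  (\int[mu]_(x in `[0%R, T]) (`|g x| ^+ p)%:E < +oo)%E.

Definition simple_val n (E : 'I_n -> set R) (v : 'I_n -> op) (x : R) : op :=
  \sum_(j < n) (\1_(E j) x)%:C *: v j.

Definition simple_int n (E : 'I_n -> set R) (v : 'I_n -> op) : op :=
  \sum_(j < n) (fine (mu (E j)))%:C *: v j.

(* X is the Bochner integral of f over [0, t], i.e., the limit of integrals of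
   simple functions converging to f both a.e. and in L^1. The integral below
   is the supremum over Borel simple minorants, which agrees with the Lebesgue
   integral for the integrand, an a.e. limit of measurable functions. *)
Definition bochner_integral (t : R) (f : R -> op) X := vna F X /\
  exists (m : nat -> nat) (E : forall n, 'I_(m n) -> set R)
         (v : forall n, 'I_(m n) -> op),
  [/\ forall n j, [/\ measurable (E n j), E n j `<=` `[0, t] & vna F (v n j)],
      {ae mu, forall x, x \in `[0, t] ->
        (fun n => opnorm (f x - simple_val (E n) (v n) x)) @ \oo --> (0 : R)},
      ((fun n => \int[mu]_(x in `[0%R, t])
         (opnorm (f x - simple_val (E n) (v n) x))%:E) @ \oo --> 0)%E &
      (fun n => opnorm (simple_int (E n) (v n) - X)) @ \oo --> (0 : R)].

Variable W : R -> op.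

(* The partition of [0, t] given by a strictly increasing list s ending at t,
   the left endpoint 0 being implicit. *)
Definition free_sum (b c : R -> op) (s : seq R) : op :=
  \sum_(j < size s)
    (b (nth 0 (0 :: s) j)
     \o (W (nth 0 s j) - W (nth 0 (0 :: s) j))
     \o c (nth 0 (0 :: s) j)).

Definition mesh_lt (s : seq R) (d : R) :=
  forall j, (j < size s)%N -> nth 0 s j - nth 0 (0 :: s) j < d.

(* X is the integral over [0, t] of b dW c. *)
Definition free_integral (t : R) (b c : R -> op) X := vna F X /\
  forall e : R, 0 < e -> exists2 d : R, 0 < d &
    forall s, itv_partition 0 t s -> mesh_lt s d ->
      opnorm (free_sum b c s - X) < e.

Definition coef_adapted (f : op -> op) := forall t, 0 <= t ->
  forall U, vna_sa U -> filtration W t U -> filtration W t (f U).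

Section Coefficients.
Variables (k : nat) (alpha : op -> op) (beta gamma : 'I_k -> op -> op).
Variables (T : R) (U0 : op).

Record fsde_solution (U : R -> op) : Prop := FsdeSolution {
  fsde_adapted : forall t, t \in `[0, T] ->
    vna_sa (U t) /\ filtration W t (U t) ;
  fsde_init : U 0 = U0 ;
  fsde_drift : in_Lp 1 T (fun t => opnorm (alpha (U t))) ;
  fsde_noise : forall i,
    in_Lp 2 T (fun t => opnorm (beta i (U t)) * opnorm (gamma i (U t))) ;
  fsde_eq : forall t, t \in `[0, T] -> exists (D : op) (N : 'I_k -> op),
    [/\ bochner_integral t (fun s => alpha (U s)) D,
        forall i, free_integral t (fun s => beta i (U s))
                                  (fun s => gamma i (U s)) (N i) &
        U t = U0 + D + \sum_i N i] }.

Definition fsde_unique_solution (U : R -> op) := fsde_solution U /\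
  forall V : R -> op, fsde_solution V -> forall t, t \in `[0, T] -> V t = U t.

Section Scheme.
Variables (theta : R) (P : nat).

Definition step : R := T / P%:R.

Definition grid (n : nat) : R := n%:R * step.

Definition noise (Ub : nat -> op) (n : nat) : op :=
  \sum_(i < k) (beta i (Ub n) \o (W (grid n.+1) - W (grid n))
                              \o gamma i (Ub n)).

Record theta_scheme (Ub : nat -> op) : Prop := ThetaScheme {
  scheme_sa : forall n, (n <= P)%N -> vna_sa (Ub n) ;
  scheme_adapted : forall n, (n <= P)%N -> filtration W (grid n) (Ub n) ;
  scheme_init : Ub 0%N = U0 ;
  scheme_eq : forall n, (n < P)%N ->
    Ub n.+1 = Ub n + ((1 - theta) * step)%:C *: alpha (Ub n)
              + (theta * step)%:C *: alpha (Ub n.+1) + noise Ub n }.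

Definition theta_scheme_unique (Ub : nat -> op) := theta_scheme Ub /\
  forall Vb : nat -> op, theta_scheme Vb -> forall n, (n <= P)%N -> Vb n = Ub n.

End Scheme.
End Coefficients.

Definition L2_lipschitz (f : op -> op) := exists2 L : R, 0 < L &
  forall U V, vna_sa U -> vna_sa V -> norm2 (f U - f V) <= L * norm2 (U - V).

Definition L2_locally_lipschitz (f : op -> op) :=
  forall M : R, 0 < M -> exists2 L : R, 0 < L &
  forall U V, vna_sa U -> vna_sa V -> norm2 U <= M -> norm2 V <= M ->
    norm2 (f U - f V) <= L * norm2 (U - V).

End FreeProbability.

(* Main.v *)
Require Import Defs.
From HB Require Import structures.
From mathcomp Require Import all_boot all_order all_algebra sesquilinear.
From mathcomp Require Import complex.
From mathcomp Require Import all_classical all_reals all_analysis.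
From mathcomp Require Import measurable_realfun.
From mathcomp Require Import ring lra.
Import Order.TTheory GRing.Theory Num.Theory.
Import numFieldNormedType.Exports.
Local Open Scope classical_set_scope.
Local Open Scope ring_scope.
Set Implicit Arguments.
Unset Strict Implicit.
Unset Printing Implicit Defensive.

(** The error estimate is the mean square analysis of the Euler scheme, carried
    out in the inner product [l2ip] of the trace, with two facts from free
    probability in place of the Itô isometry and the martingale property. If [w]
    is the increment of the free Brownian motion after time [s], of length [d],
    and [b], [c] are self-adjoint and known at time [s], then freeness evaluates
    the trace of [c w b b w c] as the product of the squares of [norm2 b] and
    [norm2 c] and of the variance of [w]; hence [norm2 (b w c)] is at most
    [4 sqrt d] times [norm2 b * norm2 c] ([norm2_increment]). Moreover [b w c] is
    orthogonal to everything known at time [s] ([l2ip_increment]). Only the norm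
    [norm2] of the coefficients enters, which is the norm in which they are
    Lipschitz; the variance enters through a bound linear in [d]
    ([semicircle_second_moment]).

    Both facts pass from single increments to Riemann sums and then to stochastic
    integrals ([free_integral_frozen]), because the operator norm dominates
    [norm2] ([norm2_le_opnorm]). The drift is compared with a constant by pairing
    the Bochner integral with a fixed operator ([bochner_frozen]). It follows that
    the solution is Hölder continuous of order [1/2] in [norm2]
    ([solution_holder]). In one step of the scheme the drift error is of size
    [h (sqrt h + e + e')], where [e] and [e'] are the errors before and after the
    step, while the noise error is of size [sqrt h (sqrt h + e)] but orthogonal to
    the previous error. Squares therefore satisfy a recursion
    [e'^2 <= e^2 + Lam h (h + e^2 + e'^2)] ([error_step]), and a discrete Gronwall
    argument gives [e^2 <= E h] with [E = exp (4 Lam T)].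

    The noise coefficients are only locally Lipschitz, so the recursion needs an a
    priori bound on the scheme. None is proved separately: the solution lies in a
    ball of radius [M], the recursion holds as long as the previous error is at
    most [1], and for [E h <= 1] the estimate it yields keeps the next error below
    [1] ([bootstrapped_gronwall]). The uniform bound on the scheme is then a
    consequence of the convergence estimate. *)

(** * Operators on a Hilbert space *)

Section HilbertOperators.
Local Open Scope complex_scope.
Context {R : realType} {H : hilbertSpace R}.
Local Notation op := (H -> H).
Implicit Types (T U V X Y : op) (x y z : H).

Lemma ipDl x y z : ip H (x + y) z = ip H x z + ip H y z.
Proof. exact: linearDl. Qed.

Lemma ipDr x y z : ip H x (y + z) = ip H x y + ip H x z.
Proof. exact: linearDr. Qed.

Lemma ipBl x y z : ip H (x - y) z = ip H x z - ip H y z.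
Proof. exact: linearBl. Qed.

Lemma ipBr x y z : ip H x (y - z) = ip H x y - ip H x z.
Proof. exact: linearBr. Qed.

Lemma ipZl (a : R[i]) x y : ip H (a *: x) y = a * ip H x y.
Proof. exact: linearZl_LR. Qed.

Lemma ipZr (a : R[i]) x y : ip H x (a *: y) = conjc a * ip H x y.
Proof. exact: linearZr_LR. Qed.

Lemma ipC x y : ip H x y = conjc (ip H y x).
Proof. by rewrite hermC expr0 mul1r. Qed.

Lemma ip_inj x y : (forall z, ip H z x = ip H z y) -> x = y.
Proof.
move=> e; apply/eqP; rewrite -subr_eq0; apply/negPn/negP => n0.
have := @neq0_dnorm_gt0 _ _ _ (ip H) _ n0.
by rewrite ipBr e subrr ltxx.
Qed.

Lemma is_adjoint_uniq T U V : is_adjoint T U -> is_adjoint T V -> U = V.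
Proof. by move=> TU TV; apply/funext => y; apply: ip_inj => x; rewrite -TU -TV. Qed.

Lemma is_adjointC T U : is_adjoint T U -> is_adjoint U T.
Proof. by move=> TU x y; rewrite ipC -TU -ipC. Qed.

(** [adj] is defined by choice; uniqueness of adjoints makes it computable. *)
Lemma adj_eq T U : is_adjoint T U -> adj T = U.
Proof.
move=> TU; apply: (@is_adjoint_uniq T) => //.
by rewrite /adj; case: xgetP => [V _|/(_ U)] //.
Qed.

Lemma is_adjointD T U T' U' :
  is_adjoint T U -> is_adjoint T' U' -> is_adjoint (T + T') (U + U').
Proof. by move=> a b x y; rewrite !fctE ipDl ipDr a b. Qed.

Lemma is_adjointZ (c : R[i]) T U :
  is_adjoint T U -> is_adjoint (c *: T) (conjc c *: U).
Proof. by move=> a x y; rewrite !fctE ipZl ipZr conjcK a. Qed.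

Lemma is_adjoint_comp T U T' U' :
  is_adjoint T U -> is_adjoint T' U' -> is_adjoint (T \o T') (U' \o U).
Proof. by move=> a b x y; rewrite /= a b. Qed.

(** Norms of vectors are complex numbers; their real parts are easier to order
    and to multiply. *)
Definition hnorm (x : H) : R := complex.Re `|x|.

Lemma hnormE x : `|x| = (hnorm x)%:C.
Proof. by rewrite /hnorm RRe_real// ger0_real. Qed.

Lemma hnorm_ge0 x : 0 <= hnorm x.
Proof. by rewrite -ler0c -hnormE. Qed.

Lemma hnorm0 : hnorm 0 = 0.
Proof. by rewrite /hnorm normr0. Qed.

Lemma hnorm_eq0 x : (hnorm x == 0) = (x == 0).
Proof. by rewrite -(normr_eq0 x) hnormE -(inj_eq (@complexI R)). Qed.

Lemma hnormZ (c : R) x : 0 <= c -> hnorm (c%:C *: x) = c * hnorm x.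
Proof.
move=> c0; apply: complexI; have := normrZ (c%:C) x; rewrite !hnormE => ->.
by rewrite rmorphM/= ger0_norm// ler0c.
Qed.

Lemma hnorm_ip x : ip H x x = (hnorm x ^+ 2)%:C.
Proof. by rewrite -ip_norm hnormE -rmorphXn. Qed.

Lemma linear0f T : linear T -> T 0 = 0.
Proof. by move=> /(_ (-1) 0 0); rewrite scaler0 addr0 scaleN1r addNr. Qed.

Lemma linearDf T x y : linear T -> T (x + y) = T x + T y.
Proof. by move=> /(_ 1 x y); rewrite !scale1r. Qed.

Lemma linearZf T (c : R[i]) x : linear T -> T (c *: x) = c *: T x.
Proof. by move=> lT; have := lT c x 0; rewrite (linear0f lT) !addr0. Qed.

Lemma linearNf T x : linear T -> T (- x) = - T x.
Proof. by move=> lT; rewrite -scaleN1r (linearZf _ _ lT) scaleN1r. Qed.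

Lemma linear_boundedP T : bounded_linear T ->
  linear T /\ exists M : R, 0 <= M /\ forall x, hnorm (T x) <= M * hnorm x.
Proof.
move=> [lT [M bM]]; split=> //; exists (Num.max M 0); split.
  by rewrite le_max lexx orbT.
move=> x; have := bM x; rewrite !hnormE -rmorphM /= lecR => /le_trans; apply.
by rewrite ler_wpM2r ?hnorm_ge0// le_max lexx.
Qed.

Lemma opnorm_set T :
  [set complex.Re `|T x| | x in [set x : H | `|x| <= 1]] =
  [set hnorm (T x) | x in [set x | hnorm x <= 1]].
Proof.
rewrite /hnorm; congr (image _ _); apply/funext => x /=.
by rewrite hnormE -(rmorph1 (real_complex R)) lecR.
Qed.

Lemma opnorm_has_sup T : bounded_linear T ->
  has_sup [set hnorm (T x) | x in [set x | hnorm x <= 1]].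
Proof.
move=> /linear_boundedP[lT [M [M0 bM]]]; split.
  by exists (hnorm (T 0)), 0 => //=; rewrite hnorm0.
exists M => _ [x /= x1 <-]; apply: le_trans (bM x) _.
by rewrite ler_piMr.
Qed.

Lemma opnorm_ge0 T : bounded_linear T -> 0 <= opnorm T.
Proof.
move=> bT; rewrite /opnorm opnorm_set; apply: le_trans (hnorm_ge0 (T 0)) _.
by apply: sup_upper_bound; [exact: opnorm_has_sup|exists 0; rewrite //= hnorm0].
Qed.

Lemma opnormP T x : bounded_linear T -> hnorm (T x) <= opnorm T * hnorm x.
Proof.
move=> bT; have [lT _] := bT.
have [->|x0] := eqVneq x 0; first by rewrite (linear0f lT) hnorm0 mulr0.
have hx : 0 < hnorm x by rewrite lt_neqAle hnorm_ge0 eq_sym hnorm_eq0 x0.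
have: hnorm (T ((hnorm x)^-1%:C *: x)) <= opnorm T.
  rewrite /opnorm opnorm_set; apply: sup_upper_bound; first exact: opnorm_has_sup.
  by exists ((hnorm x)^-1%:C *: x) => //=; rewrite hnormZ ?invr_ge0 ?hnorm_ge0// mulVf// gt_eqF.
by rewrite (linearZf _ _ lT) hnormZ ?invr_ge0 ?hnorm_ge0// mulrC ler_pdivrMr.
Qed.

End HilbertOperators.

(** * The trace and its inner product *)

Section VonNeumann.
Local Open Scope complex_scope.
Context {R : realType} {H : hilbertSpace R}.
Local Notation op := (H -> H).
Implicit Types (A S : set op) (T U V X Y : op).

Lemma compDl U V X : (U + V) \o X = (U \o X) + (V \o X).
Proof. by []. Qed.

Lemma compZl (c : R[i]) U X : (c *: U) \o X = c *: (U \o X).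
Proof. by []. Qed.

Lemma compDr T U V : linear T -> T \o (U + V) = (T \o U) + (T \o V).
Proof. by move=> lT; apply/funext => x /=; rewrite !fctE linearDf. Qed.

Lemma compZr (c : R[i]) T U : linear T -> T \o (c *: U) = c *: (T \o U).
Proof. by move=> lT; apply/funext => x /=; rewrite !fctE linearZf. Qed.

Section Closure.
Variable (A : set op).
Hypothesis vA : von_neumann A.

Lemma vn_blin U : A U -> bounded_linear U.
Proof. exact: vn_bounded vA U. Qed.

Lemma vn_lin U : A U -> linear U.
Proof. by move=> /vn_blin[]. Qed.

Lemma vn0 : A 0.
Proof.
have := vn_linear vA (-1) (vn_one vA) (vn_one vA).
by rewrite scaleN1r addNr.
Qed.

Lemma vnD U V : A U -> A V -> A (U + V).
Proof. by move=> aU aV; have := vn_linear vA 1 aU aV; rewrite scale1r. Qed.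

Lemma vnZ (c : R[i]) U : A U -> A (c *: U).
Proof. by move=> aU; have := vn_linear vA c aU vn0; rewrite addr0. Qed.

Lemma vnN U : A U -> A (- U).
Proof. by move=> /(vnZ (-1)); rewrite scaleN1r. Qed.

Lemma vnB U V : A U -> A V -> A (U - V).
Proof. by move=> aU aV; apply: vnD => //; exact: vnN. Qed.

Lemma vn_sum (I : Type) (s : seq I) (P : pred I) (f : I -> op) :
  (forall i, P i -> A (f i)) -> A (\sum_(i <- s | P i) f i).
Proof. by move=> Af; apply: (big_ind A) => //; [exact: vn0|exact: vnD]. Qed.

Lemma adjP U : A U -> is_adjoint U (adj U).
Proof. by move=> /(vn_adj vA)[V _ UV]; rewrite (adj_eq UV). Qed.

Lemma vn_adjA U : A U -> A (adj U).
Proof. by move=> /(vn_adj vA)[V AV UV]; rewrite (adj_eq UV). Qed.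

Lemma vn_iter n U : A U -> A (iter n U).
Proof. by move=> AU; elim: n => [|n IH]; [exact: (vn_one vA)|exact: (vn_mul vA AU IH)]. Qed.

Lemma vn_alg X : A X -> alg_gen X `<=` A.
Proof.
move=> AX _ [p _ <-]; apply: vn_sum => i _.
by apply: vnZ; exact: vn_iter.
Qed.

Lemma vn_gen_sub S : S `<=` A -> vn_gen S `<=` A.
Proof. by move=> SA U; apply. Qed.

(** Adjoints are unique, so the adjoint of an element of the intersection of
    all the algebras containing [S] lies in each of them. *)
Lemma vn_gen_von_neumann S : S `<=` A -> von_neumann (vn_gen S).
Proof.
move=> SA; split.
- by move=> U /(_ A vA SA) /vn_blin.
- by move=> B vB _; exact: vn_one vB.
- by move=> c U V gU gV B vB SB; apply: vn_linear => //; [exact: gU|exact: gV].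
- by move=> U V gU gV B vB SB; apply: vn_mul => //; [exact: gU|exact: gV].
- move=> U gU; have AU := gU A vA SA; exists (adj U); last exact: adjP.
  move=> B vB SB; have [V BV UV] := vn_adj vB (gU B vB SB).
  by rewrite (adj_eq UV).
- move=> U [bU cU] B vB SB; apply: (vn_closed vB); split=> // s e e0.
  by have [V gV hV] := cU s e e0; exists V => //; exact: gV.
Qed.

End Closure.

Lemma selfadjointD U V : selfadjoint U -> selfadjoint V -> selfadjoint (U + V).
Proof. exact: is_adjointD. Qed.

Lemma selfadjointZ (c : R) U : selfadjoint U -> selfadjoint (c%:C *: U).
Proof. by move=> /(is_adjointZ c%:C); rewrite /selfadjoint conjc_real. Qed.

Lemma selfadjointN U : selfadjoint U -> selfadjoint (- U).
Proof. by move=> /(selfadjointZ (-1)); rewrite rmorphN rmorph1 scaleN1r. Qed.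

End VonNeumann.

Section TraceL2.
Local Open Scope complex_scope.
Context {R : realType} {F : ncProbSpace R}.
Local Notation op := (F -> F).
Implicit Types (U V X Y Z : op).

Let vF := vna_von_neumann F.
Let tF := psi_tracial F.

Lemma psiD U V : vna F U -> vna F V -> psi F (U + V) = psi F U + psi F V.
Proof. by move=> fU fV; have := ts_linear tF 1 fU fV; rewrite scale1r mul1r. Qed.

Lemma psi0 : psi F 0 = 0.
Proof.
have := psiD (vn0 vF) (vn0 vF); rewrite addr0 => /eqP.
by rewrite -subr_eq0 opprD addNKr oppr_eq0 => /eqP.
Qed.

Lemma psiZ (c : R[i]) U : vna F U -> psi F (c *: U) = c * psi F U.
Proof. by move=> fU; have := ts_linear tF c fU (vn0 vF); rewrite addr0 psi0 addr0. Qed.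

Lemma psi_id (c : R[i]) : psi F (c *: idfun) = c.
Proof. by rewrite psiZ ?(ts_one tF) ?mulr1//; exact: vn_one vF. Qed.

(** A set with two elements [X <= Y] is directed with least upper bound [Y], so
    normality gives monotonicity of the trace without square roots of positive
    operators. *)
Lemma psi_le X Y : vna F X -> vna F Y -> selfadjoint X -> selfadjoint Y ->
  op_le X Y -> complex.Re (psi F X) <= complex.Re (psi F Y).
Proof.
move=> fX fY sX sY XY.
have YY : op_le Y Y by move=> x; rewrite subrr linear0l.
rewrite (@psi_normal _ F [set X; Y] Y)//.
- apply: sup_upper_bound; last by exists X => //; left.
  split; first by exists (complex.Re (psi F X)), X => //; left.
  exists (Num.max (complex.Re (psi F X)) (complex.Re (psi F Y))).
  by move=> _ [Z [->|->] <-]; rewrite le_max lexx ?orbT.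
- by exists X; left.
- by move=> U [->|->].
- by move=> U V [->|->] [->|->]; exists Y => //; by [right|split].
- by move=> U [->|->].
- by move=> V _ _; apply; right.
Qed.

Definition l2form X Y : R[i] := psi F (adj Y \o X).

(** The real part of the GNS inner product already determines [norm2] and
    suffices for every orthogonality statement below. *)
Definition l2ip X Y : R := complex.Re (psi F (adj Y \o X)).

Let fadj U : vna F U -> vna F (adj U). Proof. exact: vn_adjA. Qed.
Let fM U V : vna F U -> vna F V -> vna F (U \o V). Proof. exact: vn_mul. Qed.

Lemma adjD X Y : vna F X -> vna F Y -> adj (X + Y) = adj X + adj Y.
Proof. by move=> fX fY; apply/adj_eq/is_adjointD; exact: (adjP vF). Qed.

Lemma adjZ (c : R[i]) X : vna F X -> adj (c *: X) = conjc c *: adj X.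
Proof. by move=> fX; apply/adj_eq/is_adjointZ; exact: (adjP vF). Qed.

Lemma l2formDl X Y Z : vna F X -> vna F Y -> vna F Z ->
  l2form (X + Y) Z = l2form X Z + l2form Y Z.
Proof.
move=> fX fY fZ; rewrite /l2form compDr; last by apply: (vn_lin vF); exact: fadj.
by rewrite psiD//; apply: fM => //; exact: fadj.
Qed.

Lemma l2formDr X Y Z : vna F X -> vna F Y -> vna F Z ->
  l2form Z (X + Y) = l2form Z X + l2form Z Y.
Proof.
move=> fX fY fZ; rewrite /l2form adjD// compDl.
by rewrite psiD//; apply: fM => //; exact: fadj.
Qed.

Lemma l2formZl c X Z : vna F X -> vna F Z -> l2form (c *: X) Z = c * l2form X Z.
Proof.
move=> fX fZ; rewrite /l2form compZr; last by apply: (vn_lin vF); exact: fadj.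
by rewrite psiZ//; apply: fM => //; exact: fadj.
Qed.

Lemma l2formZr c X Z : vna F X -> vna F Z ->
  l2form Z (c *: X) = conjc c * l2form Z X.
Proof.
move=> fX fZ; rewrite /l2form adjZ// compZl.
by rewrite psiZ//; apply: fM => //; exact: fadj.
Qed.

Lemma l2form_ge0 X : vna F X -> 0 <= l2form X X.
Proof. by move=> fX; apply: (ts_pos tF) => //; [exact: fadj|exact: (adjP vF)]. Qed.

Lemma l2ipDl X Y Z : vna F X -> vna F Y -> vna F Z ->
  l2ip (X + Y) Z = l2ip X Z + l2ip Y Z.
Proof. by move=> *; rewrite /l2ip -!/(l2form _ _) l2formDl// raddfD. Qed.

Lemma l2ipZl (c : R) X Z : vna F X -> vna F Z ->
  l2ip (c%:C *: X) Z = c * l2ip X Z.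
Proof.
move=> *; rewrite /l2ip -!/(l2form _ _) l2formZl//.
by case: (l2form _ _) => a b; rewrite /= mul0r subr0.
Qed.

Lemma l2ip_ge0 X : vna F X -> 0 <= l2ip X X.
Proof. by move=> /l2form_ge0; rewrite lecE => /andP[]. Qed.

(** Symmetry of the real part is read off from the positivity of the form at
    [X + i Y]. *)
Lemma l2ipC X Y : vna F X -> vna F Y -> l2ip X Y = l2ip Y X.
Proof.
move=> fX fY.
have fiY := vnZ vF 'i%C fY.
have := l2form_ge0 (vnD vF fX fiY).
rewrite l2formDl// ?l2formDr//; last exact: (vnD vF).
rewrite !(l2formZl, l2formZr)//.
have := l2form_ge0 fX; have := l2form_ge0 fY.
rewrite /l2ip -!/(l2form _ _).
case: (l2form X X) => a1 b1; case: (l2form Y Y) => a2 b2.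
case: (l2form X Y) => a3 b3; case: (l2form Y X) => a4 b4.
by rewrite !lecE /= => /andP[/eqP ? _] /andP[/eqP ? _] /andP[/eqP ? _]; lra.
Qed.

Lemma l2ipDr X Y Z : vna F X -> vna F Y -> vna F Z ->
  l2ip Z (X + Y) = l2ip Z X + l2ip Z Y.
Proof.
by move=> fX fY fZ; rewrite ![l2ip Z _]l2ipC ?l2ipDl//; exact: (vnD vF).
Qed.

Lemma l2ipZr (c : R) X Z : vna F X -> vna F Z ->
  l2ip Z (c%:C *: X) = c * l2ip Z X.
Proof.
by move=> fX fZ; rewrite ![l2ip Z _]l2ipC ?l2ipZl//; exact: (vnZ vF).
Qed.

Lemma l2ip0l X : vna F X -> l2ip 0 X = 0.
Proof.
by move=> fX; have := l2ipZl 0 fX fX; rewrite rmorph0 scale0r mul0r.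
Qed.

Lemma l2ip_sumr (I : Type) (s : seq I) (P : pred I) (f : I -> op) Z : vna F Z ->
  (forall i, P i -> vna F (f i)) ->
  l2ip Z (\sum_(i <- s | P i) f i) = \sum_(i <- s | P i) l2ip Z (f i).
Proof.
move=> fZ ff.
suff [] : vna F (\sum_(i <- s | P i) f i) /\ 
  l2ip Z (\sum_(i <- s | P i) f i) = \sum_(i <- s | P i) l2ip Z (f i) by [].
apply: (big_ind2 (fun x y => vna F x /\ l2ip Z x = y)).
- by split; [exact: vn0|rewrite l2ipC ?l2ip0l//; exact: vn0].
- by move=> x1 x2 y1 y2 [fx1 <-] [fy1 <-]; rewrite l2ipDr//; split => //; exact: (vnD vF).
- by move=> i Pi; split => //; exact: ff.
Qed.

Lemma norm2_ge0 X : 0 <= norm2 X.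
Proof. exact: sqrtr_ge0. Qed.

Lemma sqr_norm2 X : vna F X -> norm2 X ^+ 2 = l2ip X X.
Proof. by move=> fX; rewrite sqr_sqrtr//; exact: l2ip_ge0. Qed.

Lemma sqr_norm2D X Y : vna F X -> vna F Y ->
  norm2 (X + Y) ^+ 2 = norm2 X ^+ 2 + 2 * l2ip X Y + norm2 Y ^+ 2.
Proof.
move=> fX fY; have fXY := vnD vF fX fY.
rewrite !sqr_norm2// l2ipDl// !l2ipDr// (l2ipC fY fX); ring.
Qed.

Lemma norm2Z (c : R) X : vna F X -> norm2 (c%:C *: X) = `|c| * norm2 X.
Proof.
move=> fX; have fcX := vnZ vF c%:C fX.
apply/eqP; rewrite -(@eqrXn2 _ 2)// ?mulr_ge0 ?norm2_ge0//.
by rewrite exprMn real_normK ?num_real// !sqr_norm2// l2ipZl// l2ipZr// mulrA.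
Qed.

Lemma norm2N X : vna F X -> norm2 (- X) = norm2 X.
Proof.
move=> fX; have := norm2Z (-1) fX.
by rewrite rmorphN rmorph1 scaleN1r normrN1 mul1r.
Qed.

Lemma norm2_0 : norm2 (0 : op) = 0.
Proof.
have := norm2Z 0 (vn0 vF); by rewrite rmorph0 scale0r normr0 mul0r.
Qed.

Lemma norm2_sub X Y : vna F X -> vna F Y -> norm2 (X - Y) = norm2 (Y - X).
Proof. by move=> fX fY; rewrite -norm2N ?opprB//; exact: (vnB vF). Qed.

(** Nonnegativity of the square of [a X + b Y] is used at [a = |Y|], [b = - |X|],
    and, when one of the norms vanishes, at coefficients for which a positive
    inner product would make it negative. *)
Lemma l2_cauchy X Y : vna F X -> vna F Y -> l2ip X Y <= norm2 X * norm2 Y.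
Proof.
move=> fX fY.
have nX := norm2_ge0 X; have nY := norm2_ge0 Y.
have key (a b : R) : 0 <= a ^+ 2 * norm2 X ^+ 2 + 2 * (a * b * l2ip X Y) + b ^+ 2 * norm2 Y ^+ 2.
  have faX := vnZ vF a%:C fX; have fbY := vnZ vF b%:C fY.
  have := sqr_norm2D faX fbY; rewrite l2ipZl// l2ipZr//.
  rewrite !norm2Z// !exprMn !real_normK ?num_real// => e.
  have := sqr_ge0 (norm2 (a%:C *: X + b%:C *: Y)); rewrite e; nra.
have [x0|x0] := eqVneq (norm2 X) 0.
  rewrite x0 mul0r leNgt; apply/negP => p.
  have := key (- (norm2 Y ^+ 2 + 1)) (l2ip X Y).
  rewrite x0; have := sqr_ge0 (norm2 Y); set y := _ ^+ 2; set l := l2ip _ _ in p *.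
  move=> y0; rewrite leNgt => /negP; apply; nra.
have [y0|y0] := eqVneq (norm2 Y) 0.
  rewrite y0 mulr0 leNgt; apply/negP => p.
  have := key (l2ip X Y) (- (norm2 X ^+ 2 + 1)).
  rewrite y0; have := sqr_ge0 (norm2 X); set y := _ ^+ 2; set l := l2ip _ _ in p *.
  move=> y1; rewrite leNgt => /negP; apply; nra.
have px : 0 < norm2 X by rewrite lt_def x0.
have py : 0 < norm2 Y by rewrite lt_def y0.
have := key (norm2 Y) (- norm2 X).
have pxy := mulr_gt0 px py.
move=> k; rewrite -(ler_pM2l pxy); nra.
Qed.

Lemma l2ipNl X Z : vna F X -> vna F Z -> l2ip (- X) Z = - l2ip X Z.
Proof.
by move=> fX fZ; have := l2ipZl (-1) fX fZ; rewrite rmorphN rmorph1 scaleN1r mulN1r.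
Qed.

Lemma l2ipBl X Y Z : vna F X -> vna F Y -> vna F Z ->
  l2ip (X - Y) Z = l2ip X Z - l2ip Y Z.
Proof. by move=> fX fY fZ; rewrite l2ipDl ?l2ipNl//; exact: (vnN vF). Qed.

Lemma normr_l2ip_le X Y : vna F X -> vna F Y -> `|l2ip X Y| <= norm2 X * norm2 Y.
Proof.
move=> fX fY; rewrite ler_norml l2_cauchy// andbT lerNl -l2ipNl// -(norm2N fX).
by apply: l2_cauchy => //; exact: (vnN vF).
Qed.

Lemma norm2D X Y : vna F X -> vna F Y -> norm2 (X + Y) <= norm2 X + norm2 Y.
Proof.
move=> fX fY; rewrite -(@ler_pXn2r _ 2) ?nnegrE ?addr_ge0 ?norm2_ge0//.
have := l2_cauchy fX fY; rewrite sqr_norm2D// sqrrD => c; lra.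
Qed.

Lemma norm2B X Y : vna F X -> vna F Y -> norm2 (X - Y) <= norm2 X + norm2 Y.
Proof. by move=> fX fY; rewrite -(norm2N fY) norm2D//; exact: (vnN vF). Qed.

Lemma norm2_tri X Y Z : vna F X -> vna F Y -> vna F Z ->
  norm2 (X - Y) <= norm2 (X - Z) + norm2 (Z - Y).
Proof.
move=> fX fY fZ; rewrite (_ : X - Y = (X - Z) + (Z - Y)); last by rewrite addrA subrK.
by apply: norm2D; exact: (vnB vF).
Qed.

Lemma norm2_le_dist X Y : vna F X -> vna F Y -> norm2 X <= norm2 Y + norm2 (X - Y).
Proof.
move=> fX fY; rewrite -{1}(subrK Y X) addrC; apply: norm2D => //; exact: (vnB vF).
Qed.

Lemma norm2_sum (I : Type) (s : seq I) (P : pred I) (f : I -> op) :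
  (forall i, P i -> vna F (f i)) ->
  norm2 (\sum_(i <- s | P i) f i) <= \sum_(i <- s | P i) norm2 (f i).
Proof.
move=> ff.
suff [] : vna F (\sum_(i <- s | P i) f i) /\ 
  norm2 (\sum_(i <- s | P i) f i) <= \sum_(i <- s | P i) norm2 (f i) by [].
apply: (big_ind2 (fun x y => vna F x /\ norm2 x <= y)).
- by split; [exact: vn0|rewrite norm2_0].
- move=> x1 x2 y1 y2 [fx1 h1] [fy1 h2]; split; first exact: (vnD vF).
  by apply: le_trans (norm2D fx1 fy1) _; exact: lerD.
- by move=> i Pi; split => //; exact: ff.
Qed.

(** [X^* X] lies below the scalar operator [opnorm X ^+ 2], and the trace is
    monotone. *)
Lemma norm2_le_opnorm X : vna F X -> norm2 X <= opnorm X.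
Proof.
move=> fX; have bX := vn_blin vF fX; have o0 := opnorm_ge0 bX.
rewrite -(@ler_pXn2r _ 2) ?nnegrE ?norm2_ge0// sqr_norm2//.
have -> : opnorm X ^+ 2 = complex.Re (psi F ((opnorm X ^+ 2)%:C *: idfun)).
  by rewrite psi_id.
have aX := adjP vF fX.
apply: psi_le.
- by apply: fM => //; exact: fadj.
- by apply: (vnZ vF); exact: vn_one vF.
- apply: is_adjoint_comp => //; exact: is_adjointC.
- exact: selfadjointZ.
- move=> x; rewrite !fctE /= ipBl ipZl (is_adjointC aX) !hnorm_ip.
  rewrite -rmorphM -rmorphB ler0c subr_ge0 -exprMn.
  by rewrite ler_pXn2r ?nnegrE ?mulr_ge0 ?hnorm_ge0 ?opnormP.
Qed.

End TraceL2.

(** * Moments of the semicircular law *)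

Section SemicircularMoments.
Context {R : realType}.
Local Notation mu := (@lebesgue_measure R).
Implicit Types v x : R.

Lemma continuous_semicircle m v :
  continuous (fun x : R => x ^+ m * semicircle_density v x).
Proof.
move=> x; apply: cvgM; first exact: exprn_continuous.
apply: cvgMl; apply: continuous_comp; last exact: sqrt_continuous.
apply: cvgB; first exact: cvg_cst.
exact: exprn_continuous.
Qed.

Lemma integrable_semicircle m v (a b : R) :
  mu.-integrable `[a, b] (EFin \o (fun x : R => x ^+ m * semicircle_density v x)).
Proof.
apply: continuous_compact_integrable; first exact: segment_compact.
apply: continuous_subspaceT; exact: continuous_semicircle.
Qed.

(** The integrand is odd and the interval is symmetric. *)
Lemma semicircle_mean v : 
  \int[mu]_(x in `[- (2 * Num.sqrt v), 2 * Num.sqrt v])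
     (x ^+ 1 * semicircle_density v x) = 0.
Proof.
set r := 2 * Num.sqrt v.
have r0 : 0 <= r by rewrite mulr_ge0.
set f := fun x : R => x ^+ 1 * semicircle_density v x.
have fN x : f (- x) = - f x.
  by rewrite /f /semicircle_density !expr1 sqrrN mulNr.
have fi : mu.-integrable `[-r, r] (EFin \o f) by exact: integrable_semicircle.
have e : \int[mu]_(x in `[- r, r]) f x = \int[mu]_(x in `[- r, r]) (-1 * f x).
  rewrite /Rintegral.
  have := @integration_by_substitution_oppr R f (- r) r.
  rewrite opprK => ->.
  - by congr fine; apply: eq_integral => x _ /=; rewrite fN mulN1r.
  - by rewrite -subr_ge0 opprK addr_ge0.
  - apply: continuous_subspaceT; exact: continuous_semicircle.
by move: e; rewrite RintegralZl// mulN1r => /eqP; rewrite -addr_eq0 -mulr2n mulrn_eq0 => /eqP.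
Qed.

(** The exact second moment is [v]; bounding the integrand by its supremum loses
    a constant factor but keeps the linear dependence on [v], on which the order of
    convergence rests. *)
Lemma semicircle_second_moment v : 0 < v ->
  \int[mu]_(x in `[- (2 * Num.sqrt v), 2 * Num.sqrt v])
     (x ^+ 2 * semicircle_density v x) <= 16 * v.
Proof.
move=> v0; set s := Num.sqrt v; have s0 : 0 < s by rewrite sqrtr_gt0.
have s2 : s ^+ 2 = v by rewrite sqr_sqrtr// ltW.
clearbody s; set r := 2 * s; have rE : r = 2 * s by []; clearbody r.
have r0 : 0 < r by rewrite rE mulr_gt0.
have pi2 : 2 <= pi :> R by exact: pi_ge2.
have pi0 : 0 < pi :> R by exact: pi_gt0.
have int_cst : mu.-integrable `[-r, r] (EFin \o (fun=> 2 * s : R)).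
  apply: continuous_compact_integrable; first exact: segment_compact.
  by apply: continuous_subspaceT => x; exact: cvg_cst.
apply: (@le_trans _ _ (\int[mu]_(x in `[- r, r]) (2 * s))).
  apply: le_Rintegral => //; first exact: integrable_semicircle.
  move=> x /=; rewrite in_itv/= -ler_norml => xr.
  have x2 : x ^+ 2 <= 4 * v.
    rewrite -real_normK ?num_real// -s2 (_ : 4 * s ^+ 2 = r ^+ 2); last by rewrite rE; ring.
    by rewrite ler_pXn2r ?nnegrE// ltW.
  rewrite /semicircle_density mulrA ler_pdivrMr ?mulr_gt0//.
  have d0 : Num.sqrt (4 * v - x ^+ 2) <= 2 * s.
    rewrite -rE -[leRHS]ger0_norm ?(ltW r0)// -sqrtr_sqr ler_wsqrtr//.
    rewrite rE exprMn s2; have := sqr_ge0 x; lra.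
  apply: (@le_trans _ _ (4 * v * (2 * s))).
    by rewrite ler_pM ?sqr_ge0 ?sqrtr_ge0.
  have : 0 <= s * v * (pi - 1) by rewrite !mulr_ge0 ?ltW// subr_gt0; lra.
  nra.
rewrite Rintegral_cst//= lebesgue_measure_itv/= lte_fin.
rewrite (_ : - r < r); last by lra.
rewrite /= -s2 rE; nra.
Qed.

End SemicircularMoments.

(** * Freeness of increments *)

Local Ltac vnaM :=
  repeat first [assumption | apply: (vn_mul (vna_von_neumann _))].

Section Freeness.
Local Open Scope complex_scope.
Context {R : realType} {F : ncProbSpace R}.
Local Notation op := (F -> F).
Implicit Types (A B : set op) (X Y Z b c w : op).

Let vF := vna_von_neumann F.
Let tF := psi_tracial F.

Lemma free_pair A B a b : free_sets A B -> A a -> B b ->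
  psi F a = 0 -> psi F b = 0 -> psi F (b \o a) = 0.
Proof.
move=> fAB Aa Bb a0 b0.
have := fAB 1%N false (fun j : 'I_2 => if odd j then a else b).
rewrite !big_ord_recl big_ord0 /=; apply.
- by case=> [[|[|//]]].
- by case=> [[|[|//]]].
Qed.

Lemma free_quad A B a a' b b' : free_sets A B -> A a -> A a' -> B b -> B b' ->
  psi F a = 0 -> psi F a' = 0 -> psi F b = 0 -> psi F b' = 0 ->
  psi F (b \o (a \o (b' \o a'))) = 0.
Proof.
move=> fAB Aa Aa' Bb Bb' a0 a0' b0 b0'.
have := fAB 3%N false (fun j : 'I_4 => nth idfun [:: b; a; b'; a'] j).
rewrite !big_ord_recl big_ord0 /=; apply.
- by case=> [[|[|[|[|//]]]]].
- by case=> [[|[|[|[|//]]]]].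
Qed.

Lemma alg_gen_id X : alg_gen X X.
Proof.
exists 'X => //; rewrite /poly_op size_polyX !big_ord_recl big_ord0 /=.
by rewrite !coefX/= scale0r add0r scale1r addr0.
Qed.

Lemma alg_gen_sqr X (c : R[i]) : alg_gen X (X \o X - c *: idfun).
Proof.
exists ('X^2 - c%:P) => //; rewrite /poly_op size_polyDl; last first.
  by rewrite size_polyXn size_polyN (leq_ltn_trans (size_polyC_leq1 _)).
rewrite size_polyXn !big_ord_recl big_ord0 /=.
rewrite !coefB !coefXn !coefC/= !subr0 sub0r scale0r add0r scale1r addr0.
by rewrite addrC scaleNr.
Qed.

(** Freeness only speaks of words in trace zero elements; mixed moments of other
    words are reached by writing every letter as a centred one plus a scalar. *)
Definition centred X := X - psi F X *: idfun.

Section OneIncrement.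
Variables (B : set op) (w : op).
Hypotheses (vB : von_neumann B) (BF : B `<=` vna F).
Hypotheses (fw : vna F w) (fAB : free_sets (alg_gen w) B) (w0 : psi F w = 0).

Let fM U V : vna F U -> vna F V -> vna F (U \o V). Proof. exact: vn_mul. Qed.
Let f1 : vna F idfun := vn_one vF.
Let Aw : alg_gen w `<=` vna F := vn_alg vF fw.

Lemma centred_in b : B b -> B (centred b).
Proof. by move=> Bb; apply: vnB => //; apply: vnZ => //; exact: vn_one. Qed.

Lemma psi_centred X : vna F X -> psi F (centred X) = 0.
Proof.
move=> fX; rewrite /centred psiD//; last by apply: vnN => //; exact: vnZ.
by rewrite -scaleNr psi_id subrr.
Qed.

Lemma centredK X : centred X + psi F X *: idfun = X.
Proof. exact: subrK. Qed.

Lemma free_mul_centred a b : alg_gen w a -> psi F a = 0 -> B b ->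
  psi F (b \o a) = 0.
Proof.
move=> Aa a0 Bb; rewrite -(centredK b) compDl compZl.
have Bc := centred_in Bb.
rewrite psiD ?psiZ ?compidl ?a0 ?mulr0 ?addr0//.
- by apply: (free_pair fAB) => //; apply: psi_centred; exact: BF.
- exact: Aw.
- by apply: fM; [exact: BF|exact: Aw].
- by apply: (vnZ vF); exact: Aw.
Qed.

Lemma free_mul b : B b -> psi F (b \o w) = 0.
Proof. by move=> Bb; apply: free_mul_centred => //; exact: alg_gen_id. Qed.

Lemma free_mul_sqr b : B b -> psi F (b \o (w \o w)) = psi F b * psi F (w \o w).
Proof.
move=> Bb; have fb := BF Bb; have lb := vn_lin vF fb.
rewrite -{1}(centredK (w \o w)) compDr// compZr// psiD; last 2 first.
- apply: fM => //; apply: (vnB vF); first exact: fM.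
  exact: (vnZ vF).
- exact: (vnZ vF).
rewrite free_mul_centred//; last 2 first.
- exact: alg_gen_sqr.
- exact/psi_centred/fM.
by rewrite add0r psiZ// mulrC.
Qed.

(** Expanding [b] and [c] into centred parts and scalars, the alternating word
    [c w b w] of centred letters vanishes by freeness and the other cross terms
    reduce to the two-letter case. This is the Itô isometry for one increment. *)
Lemma free_sandwich b c : B b -> B c ->
  psi F (c \o w \o b \o w) = psi F c * psi F b * psi F (w \o w).
Proof.
move=> Bb Bc; have fb := BF Bb; have fc := BF Bc.
have lw := vn_lin vF fw.
have Bb0 := centred_in Bb; have Bc0 := centred_in Bc.
have fb0 := BF Bb0; have fc0 := BF Bc0.
have fcw : vna F (c \o w) by exact: fM.
have lcw := vn_lin vF fcw.
rewrite -[in LHS](centredK b) compDr// compDl psiD; last 2 first.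
- by apply: fM => //; exact: fM.
- by apply: fM => //; apply: fM => //; exact: (vnZ vF).
rewrite compZr// compZl psiZ; last by apply: fM => //; exact: fM.
rewrite (_ : (c \o w) \o idfun \o w = c \o (w \o w))// free_mul_sqr//.
have -> : c \o w \o centred b \o w =
    centred c \o w \o centred b \o w + psi F c *: (w \o centred b \o w).
  by apply/funext => x; rewrite /centred !fctE /= subrK.
rewrite psiD; last 2 first.
- by vnaM.
- by apply: (vnZ vF); vnaM.
rewrite psiZ; last by vnaM.
rewrite (_ : centred c \o w \o centred b \o w = centred c \o (w \o (centred b \o w)))//.
rewrite (free_quad fAB)//; try exact: alg_gen_id; try exact: psi_centred.
rewrite (_ : w \o centred b \o w = w \o (centred b \o w))//.
rewrite (ts_trace tF)//; last exact: fM.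
rewrite (_ : centred b \o w \o w = centred b \o (w \o w))// free_mul_sqr//.
by rewrite psi_centred// mul0r mulr0 !add0r mulrCA mulrA.
Qed.

End OneIncrement.
End Freeness.

Section FreeBrownianMotion.
Local Open Scope complex_scope.
Context {R : realType} {F : ncProbSpace R} (W : R -> F -> F).
Hypothesis hW : free_brownian W.
Local Notation op := (F -> F).
Implicit Types (s t : R) (X Y Z b c : op).

Let vF := vna_von_neumann F.
Let tF := psi_tracial F.

Lemma filtration_gens t : [set W s | s in `[0, t]] `<=` vna F.
Proof. by move=> _ [s /= + <-]; rewrite in_itv/= => /andP[/(fbm_sa hW)[]]. Qed.

Lemma filtration_vn t : von_neumann (filtration W t).
Proof. exact (vn_gen_von_neumann vF (@filtration_gens t)). Qed.

Lemma filtration_sub t : filtration W t `<=` vna F.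
Proof. exact (vn_gen_sub vF (@filtration_gens t)). Qed.

Lemma filtration_le s t : s <= t -> filtration W s `<=` filtration W t.
Proof.
move=> st X hX A vA SA; apply: hX => // _ [r /= + <-].
rewrite in_itv/= => /andP[r0 rs]; apply: SA; exists r => //=.
by rewrite in_itv/= r0 (le_trans rs).
Qed.

Lemma filtration_W s t : 0 <= s <= t -> filtration W t (W s).
Proof. by move=> st A vA SA; apply: SA; exists s. Qed.

Lemma filtration_dW s t : 0 <= s -> s <= t -> filtration W t (W t - W s).
Proof.
move=> s0 st; apply: (vnB (filtration_vn t)); apply: filtration_W.
  by rewrite lexx andbT (le_trans s0).
by rewrite s0.
Qed.

Lemma vna_dW s t : 0 <= s -> s <= t -> vna F (W t - W s).
Proof. by move=> s0 st; exact: filtration_sub (filtration_dW s0 st). Qed.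

Lemma selfadjoint_dW s t : 0 <= s -> s <= t -> selfadjoint (W t - W s).
Proof.
move=> s0 st; apply: selfadjointD; first exact: (fbm_sa hW (le_trans s0 st)).2.
by apply: selfadjointN; exact: (fbm_sa hW s0).2.
Qed.

Lemma psi_dW s t : 0 <= s -> s < t -> psi F (W t - W s) = 0.
Proof. by move=> s0 st; have := fbm_law hW s0 st 1%N; rewrite semicircle_mean. Qed.

Lemma psi_sqr_dW s t : 0 <= s -> s < t ->
  exists2 v : R, psi F ((W t - W s) \o (W t - W s)) = v%:C & v <= 16 * (t - s).
Proof.
move=> s0 st; have := fbm_law hW s0 st 2%N.
set v := (X in _ = X%:C) => e; exists v; first exact: e.
by apply: semicircle_second_moment; rewrite subr_gt0.
Qed.

(** By traciality [Z], [b] and [c] gather on one side of the increment, which is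
    centred and free from the past. *)
Lemma l2ip_increment s t Z b c : 0 <= s -> s < t ->
  filtration W s Z -> filtration W s b -> filtration W s c ->
  l2ip Z (b \o (W t - W s) \o c) = 0.
Proof.
move=> s0 st hZ hb hc.
have sub := @filtration_sub s.
have fZ := sub _ hZ; have fb := sub _ hb; have fc := sub _ hc.
have fw := vna_dW s0 (ltW st).
rewrite l2ipC//; last by vnaM.
rewrite /l2ip; have fZ' := vn_adjA vF fZ.
rewrite (_ : _ \o _ = adj Z \o b \o (W t - W s) \o c)//.
rewrite (ts_trace tF)//; last by vnaM.
rewrite (_ : c \o _ = (c \o adj Z \o b) \o (W t - W s))//.
rewrite (free_mul (filtration_vn s) sub fw (fbm_free hW s0 st))//.
- exact: psi_dW.
- have vs := filtration_vn s.
  by apply: (vn_mul vs) => //; apply: (vn_mul vs) => //; exact: (vn_adjA vs).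
Qed.

(** The squared norm is the trace of [c w b b w c] with [w] the increment, which
    a cyclic permutation turns into the moment computed by [free_sandwich]. *)
Lemma norm2_increment s t b c : 0 <= s -> s < t ->
  filtration W s b -> filtration W s c -> selfadjoint b -> selfadjoint c ->
  norm2 (b \o (W t - W s) \o c) ^+ 2 <= 16 * (t - s) * (norm2 b * norm2 c) ^+ 2.
Proof.
move=> s0 st hb hc sb sc.
have sub := @filtration_sub s; have vs := filtration_vn s.
have fb := sub _ hb; have fc := sub _ hc.
have fw := vna_dW s0 (ltW st); have sw := selfadjoint_dW s0 (ltW st).
have [v vE vle] := psi_sqr_dW s0 st.
have fX : vna F (b \o (W t - W s) \o c) by vnaM.
have aX : is_adjoint (b \o (W t - W s) \o c) (c \o ((W t - W s) \o b)).
  by do 2 apply: is_adjoint_comp => //.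
rewrite sqr_norm2// /l2ip (adj_eq aX).
set w := W t - W s in fw sw fX aX vE *.
have -> : psi F ((c \o (w \o b)) \o (b \o w \o c)) =
    psi F ((c \o c) \o w \o (b \o b) \o w).
  rewrite [LHS](@ts_trace _ _ _ _ tF c (w \o b \o b \o w \o c)); [|by vnaM..].
  by rewrite [LHS](@ts_trace _ _ _ _ tF (w \o b \o b \o w) (c \o c)); [|by vnaM..].
rewrite (free_sandwich vs sub fw (fbm_free hW s0 st) (psi_dW s0 st)); last 2 first.
- exact: (vn_mul vs).
- exact: (vn_mul vs).
have real X : vna F X -> selfadjoint X -> psi F (X \o X) = (norm2 X ^+ 2)%:C.
  move=> fX' sX; have := l2form_ge0 fX'; rewrite sqr_norm2// /l2form /l2ip (adj_eq sX).
  by case: (psi F _) => p q; rewrite lecE /= => /andP[/eqP -> _].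
rewrite vE !real// -!rmorphM /= exprMn mulrC.
by rewrite [norm2 b ^+ 2 * _]mulrC ler_wpM2r// mulr_ge0 ?sqr_ge0.
Qed.

End FreeBrownianMotion.

(** * Riemann sums and free stochastic integrals *)

Section Partitions.
Context {R : realType}.
Implicit Types (a b d : R) (s : seq R).

Lemma path_le_last a s : path <%R a s -> a <= last a s.
Proof. by move=> p; apply: (@itv_partition_le _ _ a (last a s) s); split=> //; exact/eqP. Qed.

Lemma partition_exists d a b : 0 < d -> a <= b ->
  exists2 s, path (fun x y => (x < y) && (y - x < d)) a s & last a s = b.
Proof.
move=> d0 ab.
have [n] : exists n : nat, b - a <= n%:R * (d / 2).
  exists (Num.bound ((b - a) / (d / 2))); rewrite -ler_pdivrMr ?divr_gt0//.
  by apply/ltW/archi_boundP; rewrite divr_ge0 ?subr_ge0// ltW// divr_gt0.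
elim: n a ab => [a ab|n IH a ab hn].
  rewrite mul0r subr_le0 => ba; exists [::] => //=.
  by apply: le_anti; rewrite ab ba.
move: ab; rewrite le_eqVlt => /predU1P[<-|ab]; first by exists [::].
have [xb|bx] := leP (a + d / 2) b; last first.
  by exists [:: b] => //=; rewrite ab/= andbT; lra.
have [|s ps ls] := IH (a + d / 2) xb.
  by move: hn; rewrite -natr1; lra.
exists (a + d / 2 :: s) => //=; rewrite ps andbT; apply/andP; split; lra.
Qed.

End Partitions.

Section RiemannSums.
Local Open Scope complex_scope.
Context {R : realType} {F : ncProbSpace R} (W : R -> F -> F).
Hypothesis hW : free_brownian W.
Local Notation op := (F -> F).
Implicit Types (s : seq R) (a t d e K : R) (X Y Z B C N : op) (b c : R -> op).

Let vF := vna_von_neumann F.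

(** The Riemann sum over a partition with an arbitrary starting point, by
    recursion on the partition so that the past splits off at the head. *)
Fixpoint rsum b c a s : op :=
  if s is x :: s' then b a \o (W x - W a) \o c a + rsum b c x s' else 0.

Lemma free_sum_rsum b c s : free_sum W b c s = rsum b c 0 s.
Proof.
suff h a : \sum_(j < size s) (b (nth 0 (a :: s) j)
    \o (W (nth 0 s j) - W (nth 0 (a :: s) j)) \o c (nth 0 (a :: s) j)) =
    rsum b c a s by exact: h.
elim: s a => [|x s IH] a; first by rewrite big_ord0.
by rewrite big_ord_recl /= -IH.
Qed.

Lemma rsum_cat b c a s1 s2 :
  rsum b c a (s1 ++ s2) = rsum b c a s1 + rsum b c (last a s1) s2.
Proof. by elim: s1 a => [|x s1 IH] a /=; rewrite ?add0r// IH addrA. Qed.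

(** Freezing the coefficients one at a time: the frozen sum telescopes, and each
    of the other two sums has a difference in one of its factors. *)
Lemma rsum_split b c B C a s : vna F B -> vna F C -> 0 <= a -> path <%R a s ->
  rsum b c a s = rsum (fun r => b r - B) c a s
               + rsum (fun=> B) (fun r => c r - C) a s
               + (B \o (W (last a s) - W a) \o C).
Proof.
move=> fB fC; have lB := vn_lin vF fB.
elim: s a => [|x s IH] a a0 /=.
  by move=> _; rewrite !add0r subrr; apply/esym/funext => y; rewrite !fctE /= linear0f.
move=> /andP[ax ps]; rewrite IH ?(le_trans a0 (ltW ax))//.
have lw := vn_lin vF (vna_dW hW a0 (ltW ax)).
apply/funext => y; rewrite !fctE /=.
set w := fun z : F => W x z - W a z.
have wB u v : w (u - v) = w u - w v.
  by have := lw 1 u (- v); rewrite !scale1r -(linearNf _ lw).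
rewrite -/(w _) -!/(w _) wB (linearDf _ _ lB) (linearNf _ lB).
have -> : W (last x s) (C y) - W a (C y) = w (C y) + (W (last x s) (C y) - W x (C y)).
  by rewrite /w [RHS]addrC subrKA.
rewrite (linearDf (w _) _ lB).
by rewrite [in RHS]addrACA subrKA addrACA subrK.
Qed.

Lemma rsum_vna b c a s : 0 <= a -> path <%R a s ->
  (forall r, a <= r <= last a s -> vna F (b r) /\ vna F (c r)) ->
  vna F (rsum b c a s).
Proof.
elim: s a => [|x s IH] a a0 /=; first by move=> _ _; exact: (vn0 vF).
move=> /andP[ax ps] h; have xl := path_le_last ps.
apply: (vnD vF).
  have [fb fc] := h a (introT andP (conj (lexx a) (le_trans (ltW ax) xl))).
  have fw := vna_dW hW a0 (ltW ax); vnaM.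
apply: IH => //; first exact: le_trans (ltW ax).
by move=> r /andP[xr rl]; apply: h; rewrite rl (le_trans (ltW ax)).
Qed.

Definition adapted_sa b a t := forall r, a <= r <= t ->
  filtration W r (b r) /\ selfadjoint (b r).

Lemma adapted_sa_sub b a a' t t' : a <= a' -> t' <= t ->
  adapted_sa b a t -> adapted_sa b a' t'.
Proof.
by move=> aa tt h r /andP[ar rt]; apply: h; rewrite (le_trans aa) ?(le_trans rt).
Qed.

Lemma adapted_sa_vna b a t r : adapted_sa b a t -> a <= r <= t -> vna F (b r).
Proof. by move=> h /h[/(filtration_sub hW)]. Qed.

(** The martingale property: every increment is orthogonal to the past of its
    own left endpoint, hence to the past of the starting time. *)
Lemma l2ip_rsum b c a s Z : 0 <= a -> path <%R a s ->
  adapted_sa b a (last a s) -> adapted_sa c a (last a s) ->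
  filtration W a Z -> l2ip Z (rsum b c a s) = 0.
Proof.
elim: s a => [|x s IH] a a0 /=.
  move=> _ _ _ hZ; have fZ := filtration_sub hW hZ.
  by rewrite l2ipC ?l2ip0l//; exact: (vn0 vF).
move=> /andP[ax ps] hb hc hZ; have xl := path_le_last ps.
have ala : a <= a <= last x s by rewrite lexx (le_trans (ltW ax)).
have x0 := le_trans a0 (ltW ax).
have [hba _] := hb a ala; have [hca _] := hc a ala.
have fb := filtration_sub hW hba; have fc := filtration_sub hW hca.
have fw := vna_dW hW a0 (ltW ax); have fZ := filtration_sub hW hZ.
have hb' := adapted_sa_sub (ltW ax) (lexx _) hb.
have hc' := adapted_sa_sub (ltW ax) (lexx _) hc.
rewrite l2ipDr//; last 2 first.
- vnaM.
- apply: rsum_vna => // r hr.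
  by split; [exact: adapted_sa_vna hb' hr|exact: adapted_sa_vna hc' hr].
rewrite l2ip_increment// IH// ?addr0//.
exact: (filtration_le (ltW ax)).
Qed.

(** Orthogonality of successive increments turns the increment bound into an
    Itô-type bound for sums. *)
Lemma sqr_norm2_rsum b c a s K : 0 <= a -> path <%R a s ->
  adapted_sa b a (last a s) -> adapted_sa c a (last a s) ->
  (forall r, a <= r <= last a s -> norm2 (b r) * norm2 (c r) <= K) ->
  norm2 (rsum b c a s) ^+ 2 <= 16 * (last a s - a) * K ^+ 2.
Proof.
elim: s a => [|x s IH] a a0 /=.
  by move=> _ _ _ _; rewrite norm2_0 subrr mulr0 mul0r expr0n.
move=> /andP[ax ps] hb hc hK; have xl := path_le_last ps.
have ala : a <= a <= last x s by rewrite lexx (le_trans (ltW ax)).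
have x0 := le_trans a0 (ltW ax).
have [hba sb] := hb a ala; have [hca sc] := hc a ala.
have fb := filtration_sub hW hba; have fc := filtration_sub hW hca.
have fw := vna_dW hW a0 (ltW ax).
have hb' := adapted_sa_sub (ltW ax) (lexx _) hb.
have hc' := adapted_sa_sub (ltW ax) (lexx _) hc.
have hfst : filtration W x (b a \o (W x - W a) \o c a).
  have vx := filtration_vn hW x; have le := @filtration_le R F W a x (ltW ax).
  apply: (vn_mul vx); last exact: le.
  by apply: (vn_mul vx); [exact: le|exact: (filtration_dW hW a0 (ltW ax))].
have ffst := filtration_sub hW hfst.
rewrite sqr_norm2D//; last first.
  apply: rsum_vna => // r hr.
  by split; [exact: adapted_sa_vna hb' hr|exact: adapted_sa_vna hc' hr].
rewrite l2ip_rsum// mulr0 addr0.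
have h1 := norm2_increment hW a0 ax hba hca sb sc.
have h2 : norm2 (rsum b c x s) ^+ 2 <= 16 * (last x s - x) * K ^+ 2.
  by apply: IH => // r /andP[xr rl]; apply: hK; rewrite rl (le_trans (ltW ax)).
have h3 : (norm2 (b a) * norm2 (c a)) ^+ 2 <= K ^+ 2.
  have p0 : 0 <= norm2 (b a) * norm2 (c a) by rewrite mulr_ge0// norm2_ge0.
  by rewrite ler_pXn2r ?nnegrE ?hK//; apply: le_trans p0 (hK _ ala).
have h4 : 16 * (x - a) * (norm2 (b a) * norm2 (c a)) ^+ 2 <= 16 * (x - a) * K ^+ 2.
  by rewrite ler_wpM2l// mulr_ge0// subr_ge0 ltW.
lra.
Qed.

Lemma norm2_rsum b c a s K : 0 <= a -> path <%R a s ->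
  adapted_sa b a (last a s) -> adapted_sa c a (last a s) ->
  (forall r, a <= r <= last a s -> norm2 (b r) * norm2 (c r) <= K) ->
  norm2 (rsum b c a s) <= 4 * Num.sqrt (last a s - a) * K.
Proof.
move=> a0 ps hb hc hK; have al := path_le_last ps.
have K0 : 0 <= K.
  by apply: le_trans (hK a _); rewrite ?mulr_ge0 ?norm2_ge0 ?lexx.
have := sqr_norm2_rsum a0 ps hb hc hK.
have -> : 16 * (last a s - a) * K ^+ 2 = (4 * Num.sqrt (last a s - a) * K) ^+ 2.
  by rewrite !exprMn sqr_sqrtr ?subr_ge0//; congr (_ * _ * _); rewrite -natrX.
by rewrite ler_pXn2r ?nnegrE ?norm2_ge0 ?mulr_ge0 ?sqrtr_ge0.
Qed.

(** Concatenating fine partitions of [[0, t]] and [[t, t']] gives a fine partition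
    of [[0, t']], and the part of its Riemann sum over [[0, t]] cancels. *)
Lemma free_integral_increment b c t t' N N' e : 0 <= t -> t <= t' -> 0 < e ->
  adapted_sa b 0 t' -> adapted_sa c 0 t' ->
  free_integral W t b c N -> free_integral W t' b c N' ->
  exists s, [/\ path <%R t s, last t s = t' &
    norm2 (N' - N - rsum b c t s) <= e].
Proof.
move=> t0 tt' e0 hb hc [fN iN] [fN' iN'].
have e2 : 0 < e / 2 by rewrite divr_gt0.
have [d d0 hd] := iN _ e2; have [d' d'0 hd'] := iN' _ e2.
have dd0 : 0 < Num.min d d' by rewrite lt_min d0.
have [s ps ls] := partition_exists dd0 t0.
have [s' ps' ls'] := partition_exists dd0 tt'.
have sub (g f : rel R) : (forall x y : R, g x y -> f x y) ->
    forall a u, path g a u -> path f a u by move=> h a u; exact: sub_path.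
have plt a u : path (fun x y : R => (x < y) && (y - x < Num.min d d')) a u ->
    path <%R a u by apply: sub => x y /andP[].
have pmesh d1 a u : Num.min d d' <= d1 ->
    path (fun x y : R => (x < y) && (y - x < Num.min d d')) a u ->
    forall j, (j < size u)%N -> nth 0 u j - nth 0 (a :: u) j < d1.
  move=> d1m /(pathP 0) h j ju; have /andP[_ m] := h j ju.
  exact: lt_le_trans m d1m.
have fb r : 0 <= r <= t' -> vna F (b r) /\ vna F (c r).
  by move=> hr; split; [exact: adapted_sa_vna hb hr|exact: adapted_sa_vna hc hr].
have h1 : norm2 (rsum b c 0 s - N) <= e / 2.
  have fs : vna F (rsum b c 0 s).
    apply: rsum_vna => //; first exact: plt.
    by rewrite ls => r /andP[r0 rt]; apply: fb; rewrite r0 (le_trans rt).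
  apply: le_trans (norm2_le_opnorm (vnB vF fs fN)) _.
  rewrite -free_sum_rsum; apply/ltW/hd.
    by split; [exact: plt|rewrite ls].
  by apply: pmesh ps; rewrite ge_min lexx.
exists s'; split => //; first exact: plt.
have fs' : vna F (rsum b c t s').
  apply: rsum_vna => //; first exact: plt.
  by rewrite ls' => r /andP[tr rt]; apply: fb; rewrite rt (le_trans t0).
have fs : vna F (rsum b c 0 s).
  apply: rsum_vna => //; first exact: plt.
  by rewrite ls => r /andP[r0 rt]; apply: fb; rewrite r0 (le_trans rt).
have pss : path (fun x y : R => (x < y) && (y - x < Num.min d d')) 0 (s ++ s').
  by rewrite cat_path ps ls.
have h2 : norm2 (rsum b c 0 (s ++ s') - N') <= e / 2.
  have fss : vna F (rsum b c 0 (s ++ s')) by rewrite rsum_cat ls; exact: (vnD vF).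
  apply: le_trans (norm2_le_opnorm (vnB vF fss fN')) _.
  rewrite -free_sum_rsum; apply/ltW/hd'.
    by split; [exact: plt|rewrite last_cat ls ls'].
  by apply: pmesh pss; rewrite ge_min lexx orbT.
move: h2; rewrite rsum_cat ls => h2.
have -> : N' - N - rsum b c t s' =
    (rsum b c 0 s - N) - (rsum b c 0 s + rsum b c t s' - N').
  by rewrite !opprD opprK !addrA; rewrite [RHS](AC (1*1*1*1*1) ((5*2)*(4)*(1*3)))/= subrr addr0.
apply: le_trans (norm2B _ _) _; [exact: (vnB vF)|apply: (vnB vF) => //; exact: (vnD vF)|].
lra.
Qed.

(** Both conclusions hold for the Riemann sums left after splitting off the frozen
    increment. They survive the limit in operator norm because it dominates
    [norm2], for which the inner product is continuous. *)
Lemma free_integral_frozen b c t t' N N' B C K1 K2 : 0 <= t -> t <= t' ->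
  adapted_sa b 0 t' -> adapted_sa c 0 t' ->
  free_integral W t b c N -> free_integral W t' b c N' ->
  filtration W t B -> selfadjoint B -> filtration W t C -> selfadjoint C ->
  (forall r, t <= r <= t' -> norm2 (b r - B) * norm2 (c r) <= K1) ->
  (forall r, t <= r <= t' -> norm2 B * norm2 (c r - C) <= K2) ->
  let X := N' - N - (B \o (W t' - W t) \o C) in
  norm2 X <= 4 * Num.sqrt (t' - t) * (K1 + K2) /\
  forall Z, filtration W t Z -> l2ip Z X = 0.
Proof.
move=> t0 tt' hb hc iN iN' hB sB hC sC hK1 hK2 X.
have fB := filtration_sub hW hB; have fC := filtration_sub hW hC.
have [fN _] := iN; have [fN' _] := iN'.
have fw := vna_dW hW t0 tt'.
have fX : vna F X by apply: (vnB vF); [exact: (vnB vF)|vnaM].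
have cst D : filtration W t D -> selfadjoint D -> adapted_sa (fun=> D) t t'.
  by move=> hD sD r /andP[tr _]; split => //; exact: (filtration_le tr).
have sub f D : adapted_sa f 0 t' -> filtration W t D -> selfadjoint D ->
    adapted_sa (fun r => f r - D) t t'.
  move=> hf hD sD r /andP[tr rt].
  have [|hfr sfr] := hf r; first by rewrite rt (le_trans t0).
  split; last by apply: selfadjointD => //; exact: selfadjointN.
  by apply: (vnB (filtration_vn hW r)) => //; exact: (filtration_le tr).
have hb' := adapted_sa_sub t0 (lexx t') hb.
have hc' := adapted_sa_sub t0 (lexx t') hc.
have approx e : 0 < e -> exists Y, [/\ vna F Y, norm2 (X - Y) <= e,
    norm2 Y <= 4 * Num.sqrt (t' - t) * (K1 + K2) &
    forall Z, filtration W t Z -> l2ip Z Y = 0].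
  move=> e0.
  have [s [ps ls hs]] := free_integral_increment t0 tt' e0 hb hc iN iN'.
  have sp := rsum_split b c fB fC t0 ps.
  set Y1 := rsum (fun r => b r - B) c t s in sp.
  set Y2 := rsum (fun=> B) (fun r => c r - C) t s in sp.
  have fY1 : vna F Y1.
    apply: rsum_vna => //; rewrite ls => r hr; split.
      exact: adapted_sa_vna (sub _ _ hb hB sB) hr.
    exact: adapted_sa_vna hc' hr.
  have fY2 : vna F Y2.
    apply: rsum_vna => //; rewrite ls => r hr; split => //.
    exact: adapted_sa_vna (sub _ _ hc hC sC) hr.
  exists (Y1 + Y2); split.
  - exact: (vnD vF).
  - move: hs; rewrite sp ls; congr (norm2 _ <= _).
    by rewrite /X !opprD !addrA; rewrite [LHS](AC (1*1*1*1*1) (1*2*5*3*4)).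
  - apply: le_trans (norm2D fY1 fY2) _; rewrite mulrDr lerD//.
      rewrite -ls; apply: norm2_rsum => //; rewrite ?ls//; exact: sub.
    by rewrite -ls; apply: norm2_rsum => //; rewrite ?ls//; [exact: cst|exact: sub].
  - move=> Z hZ; have fZ := filtration_sub hW hZ.
    rewrite l2ipDr// l2ip_rsum// ?ls//; last exact: sub.
    by rewrite l2ip_rsum// ?ls ?addr0//; [exact: cst|exact: sub].
split.
  apply/ler_addgt0Pr => e e0; have [Y [fY XY hY _]] := approx e e0.
  by apply: le_trans (norm2_le_dist fX fY) _; rewrite lerD.
have half Z : filtration W t Z -> l2ip Z X <= 0.
  move=> hZ; have fZ := filtration_sub hW hZ.
  apply/ler_addgt0Pr => e e0; rewrite add0r.
  have p : 0 < norm2 Z + 1 by rewrite ltr_wpDl// norm2_ge0.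
  have [Y [fY XY _ oY]] := approx (e / (norm2 Z + 1)) (divr_gt0 e0 p).
  have fXY := vnB vF fX fY.
  rewrite -(subrK Y X) l2ipDr// oY// addr0.
  apply: le_trans (l2_cauchy fZ fXY) _.
  apply: le_trans (_ : (norm2 Z + 1) * (e / (norm2 Z + 1)) <= _).
    by rewrite ler_pM ?norm2_ge0// lerDl.
  by rewrite mulrC divfK// gt_eqF.
move=> Z hZ; apply/le_anti; rewrite half//=.
have fZ := filtration_sub hW hZ.
have := half _ (vnZ (filtration_vn hW t) (-1)%:C hZ).
by rewrite l2ipZl//; lra.
Qed.

End RiemannSums.

(** * Limits of scalar integrals *)

Section LowerIntegral.
Context d (X : measurableType d) {R : realType}.
Variable mu : {measure set X -> \bar R}.
Local Open Scope ereal_scope.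
Import HBNNSimple.

(** The integral of a nonnegative function is a supremum over simple minorants,
    hence monotone even where no measurability is available. *)
Lemma ge0_le_integral_nomeas (D : set X) (f g : X -> \bar R) :
  (forall x, D x -> 0 <= f x) -> (forall x, D x -> f x <= g x) ->
  \int[mu]_(x in D) f x <= \int[mu]_(x in D) g x.
Proof.
move=> f0 fg; rewrite (integral_mkcond D f) (integral_mkcond D g).
have fg' x : (f \_ D) x <= (g \_ D) x.
  by rewrite /patch; case: ifPn => // /set_mem; exact: fg.
have f0' x : 0 <= (f \_ D) x.
  by rewrite /patch; case: ifPn => // /set_mem; exact: f0.
rewrite !ge0_integralTE//; last by move=> x; exact: le_trans (fg' x).
apply: ereal_sup_le => _ [h hf <-].
by exists h => // x; exact: le_trans (hf x) (fg' x).
Qed.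

(** Neither [f] nor the majorants [a n] of the distance need be measurable. The
    almost everywhere convergence provides the measurable version [p] of [f], and
    monotonicity of the integral then transfers the [L^1] convergence from [a n]
    to the measurable distance between [q n] and [p]. *)
Lemma L1_limit (D : set X) (q : nat -> X -> R) (f : X -> R)
    (a : nat -> X -> R) (l : R) : measurable D ->
  (forall n, mu.-integrable D (EFin \o q n)) ->
  {ae mu, forall x, D x -> (fun n => q n x) @ \oo --> f x} ->
  (forall n x, D x -> (`|q n x - f x| <= a n x)%R) ->
  (fun n => \int[mu]_(x in D) (a n x)%:E) @ \oo --> 0 ->
  (fun n => (\int[mu]_(x in D) q n x)%R) @ \oo --> l ->
  exists p : X -> R, [/\ mu.-integrable D (EFin \o p),
    {ae mu, forall x, D x -> p x = f x} & (\int[mu]_(x in D) p x)%R = l].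
Proof.
move=> mD iq [N [mN N0 subN]] qa acv qcv.
(* off the null set the convergence is pointwise, so the truncated limit is
   measurable although [f] need not be *)
pose E := D `\` N; have mE : measurable E by exact: measurableD.
pose h n := (q n \_ E)%R; pose p := (f \_ E)%R.
have hp x : h ^~ x @ \oo --> p x.
  rewrite /h /p /patch; case: ifPn => [/set_mem[Dx Nx]|_]; last exact: cvg_cst.
  have [//|nc] := pselect (D x -> (fun n => q n x) @ \oo --> f x); first exact.
  by exfalso; apply: Nx; apply: subN.
have mq n : measurable_fun D (q n).
  by apply/measurable_EFinP; exact: measurable_int (iq n).
have mh n : measurable_fun D (h n).
  apply: measurable_funTS; apply/(measurable_restrictT _ mE).1.
  by apply: measurable_funS (mq n) => // x [].
have mp : measurable_fun D p by exact: measurable_fun_cvg mh (fun x _ => hp x).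
have hqle n x : D x -> (`|h n x - p x| <= a n x)%R.
  move=> Dx; rewrite /h /p /patch; case: ifPn => [_|_]; first exact: qa.
  by rewrite subrr normr0; exact: le_trans (qa n x Dx).
have ih n : mu.-integrable D (EFin \o h n).
  apply: le_integrable (iq n) => //; first exact/measurable_EFinP.
  move=> x Dx; rewrite lee_fin /h /patch /=; case: ifPn => // _.
  by rewrite normr0.
(* only the left-hand side is known to be measurable *)
have bnd n : \int[mu]_(x in D) (`|h n x - p x|)%:E <= \int[mu]_(x in D) (a n x)%:E.
  by apply: ge0_le_integral_nomeas => x Dx; rewrite lee_fin ?hqle.
have small (e : R) : (0 < e)%R ->
    \forall n \near \oo, \int[mu]_(x in D) (`|h n x - p x|)%:E < e%:E.
  move=> e0; have e0' : 0 < e%:E by rewrite lte_fin.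
  have : \forall n \near \oo, \int[mu]_(x in D) (a n x)%:E < e%:E.
    exact: (acv _ (open_ereal_lt' e0')).
  by apply: filterS => n; apply: le_lt_trans; exact: bnd.
have mhp n : measurable_fun D (h n \- p)%R by exact: measurable_funB.
have ip : mu.-integrable D (EFin \o p).
  have [n _ /(_ n (leqnn n)) hn] := small _ (@ltr01 R).
  have ihp : mu.-integrable D (EFin \o (h n \- p)%R).
    apply/integrableP; split; first exact/measurable_EFinP.
    exact: lt_trans hn (ltry 1).
  have := integrableB mD (ih n) ihp; apply: eq_integrable => // x _.
  by rewrite /= -EFinB opprB addrC subrK.
have hq n : (\int[mu]_(x in D) q n x = \int[mu]_(x in D) h n x)%R.
  rewrite /Rintegral; congr fine; apply: ae_eq_integral => //.
  - exact/measurable_EFinP.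
  - exact/measurable_EFinP.
  - exists N; split => // x /= /not_implyP[Dx ne]; apply: contrapT => Nx.
    by apply: ne; rewrite /h /patch mem_set.
exists p; split => //.
  exists N; split => // x /= /not_implyP[Dx ne]; apply: contrapT => Nx.
  by apply: ne; rewrite /p /patch mem_set.
suff pcv : (fun n => (\int[mu]_(x in D) q n x)%R) @ \oo -->
    (\int[mu]_(x in D) p x)%R.
  by rewrite -(cvg_lim _ pcv)// (cvg_lim _ qcv).
apply/cvgrPdist_lt => e e0; have := small _ e0; apply: filterS => n hn.
rewrite hq -RintegralB// -lte_fin; apply: le_lt_trans hn.
have ihp : mu.-integrable D (EFin \o (p \- h n)%R).
  by have := integrableB mD ip (ih n).
rewrite EFin_normr_Rintegral//; apply: le_trans (le_abse_integral _ mD _) _.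
  exact: measurable_int ihp.
by under eq_integral => x _ do rewrite /= distrC.
Qed.

End LowerIntegral.

(** * Bochner integrals *)

Section Bochner.
Local Open Scope complex_scope.
Context {R : realType} {F : ncProbSpace R}.
Local Notation op := (F -> F).
Local Notation mu := (@lebesgue_measure R).
Implicit Types (f : R -> op) (X Y Z : op) (t : R).

Let vF := vna_von_neumann F.

Lemma l2ip_suml n (c : 'I_n -> R) (v : 'I_n -> op) Z : vna F Z ->
  (forall j, vna F (v j)) ->
  l2ip (\sum_(j < n) (c j)%:C *: v j) Z = \sum_(j < n) c j * l2ip (v j) Z.
Proof.
move=> fZ fv; have fcv j : vna F ((c j)%:C *: v j) by exact: (vnZ vF).
rewrite l2ipC//; last exact: (vn_sum vF).
rewrite l2ip_sumr//; apply: eq_bigr => j _.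
by rewrite l2ipZr// l2ipC.
Qed.

Lemma mu_itvcc_fin t (E : set R) : measurable E -> E `<=` `[0, t] ->
  mu E \is a fin_num.
Proof.
move=> mE Et; rewrite ge0_fin_numE//.
have mt : (mu `[0%R, t] < +oo)%E.
  by rewrite lebesgue_measure_itv/=; case: ifP => _; rewrite ?ltry// -EFinB ltry.
by apply: le_lt_trans mt; apply: le_measure; rewrite ?inE.
Qed.

Lemma integral_simple_scalar t n (E : 'I_n -> set R) (c : 'I_n -> R) :
  (forall j, measurable (E j) /\ E j `<=` `[0, t]) ->
  let q := fun x => \sum_(j < n) \1_(E j) x * c j in
  mu.-integrable `[0, t] (EFin \o q) /\
  \int[mu]_(x in `[0, t]) q x = \sum_(j < n) fine (mu (E j)) * c j.
Proof.
move=> hE q.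
have i1 j : mu.-integrable `[0, t] (fun x => (\1_(E j) x)%:E).
  have [mE Et] := hE j.
  apply/integrableP; split.
    by apply/measurable_EFinP; exact: measurable_indic.
  under eq_integral do rewrite gee0_abs ?lee_fin//.
  rewrite integral_indic// setIidl// -ge0_fin_numE//.
  exact: mu_itvcc_fin Et.
have ic j : mu.-integrable `[0, t] (fun x => (\1_(E j) x * c j)%:E).
  by apply: eq_integrable (integrableZr _ (c j) (i1 j)) => //.
have ie : mu.-integrable `[0, t] (EFin \o q).
  suff : mu.-integrable `[0, t] (fun x => \sum_(j < n) (\1_(E j) x * c j)%:E)%E.
    by apply: eq_integrable => // x _; rewrite /= -sumEFin.
  by apply: integrable_sum.
split => //; rewrite /Rintegral.
under eq_integral do rewrite -sumEFin.
rewrite integral_sum//.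
rewrite (eq_bigr (fun j => (fine (mu (E j)) * c j)%:E)) ?sumEFin// => j _.
have [mE Et] := hE j.
under eq_integral do rewrite EFinM.
rewrite integralZr// integral_indic// setIidl// EFinM fineK//.
exact: mu_itvcc_fin Et.
Qed.

(** Pairing with a fixed [Z] is continuous for the operator norm, so the simple
    functions defining the Bochner integral are paired into a scalar sequence
    with an [L^1] limit. The function [p] is a measurable version of
    [l2ip (f x) Z], itself not known to be measurable. *)
Lemma bochner_scalar t f X Z : bochner_integral t f X -> vna F Z ->
  (forall x, 0 <= x <= t -> vna F (f x)) ->
  exists p : R -> R, [/\ mu.-integrable `[0, t] (EFin \o p),
    {ae mu, forall x, `[0, t]%classic x -> p x = l2ip (f x) Z} &
    \int[mu]_(x in `[0, t]) p x = l2ip X Z].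
Proof.
move=> [fX [m [E [v [hEv hae hL1 hI]]]]] fZ ff.
have fv n j : vna F (v n j) by case: (hEv n j).
have hE n j : measurable (E n j) /\ E n j `<=` `[0, t] by case: (hEv n j).
have fval n x : vna F (simple_val (E n) (v n) x).
  by apply: (vn_sum vF) => j _; exact: (vnZ vF).
have fint n : vna F (simple_int (E n) (v n)).
  by apply: (vn_sum vF) => j _; exact: (vnZ vF).
pose q n x := \sum_(j < m n) \1_(E n j) x * l2ip (v n j) Z.
have qE n x : q n x = l2ip (simple_val (E n) (v n) x) Z by rewrite l2ip_suml.
pose a n x := opnorm (f x - simple_val (E n) (v n) x).
(* a positive Lipschitz constant of the pairing, even when [Z = 0] *)
pose z := norm2 Z + 1.
have z0 : 0 < z by rewrite ltr_wpDl// norm2_ge0.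
have le1 Y : vna F Y -> `|l2ip Y Z| <= z * opnorm Y.
  move=> fY; apply: le_trans (normr_l2ip_le fY fZ) _.
  by rewrite mulrC ler_pM ?norm2_ge0 ?norm2_le_opnorm// lerDl.
have qa n x : 0 <= x <= t -> `|q n x - l2ip (f x) Z| <= z * a n x.
  move=> hx; have fx := ff x hx.
  rewrite qE distrC -l2ipBl//; apply: le1; exact: (vnB vF).
have inD x : `[0, t]%classic x -> 0 <= x <= t by rewrite /= in_itv.
have iq n : mu.-integrable `[0, t] (EFin \o (fun x => z^-1 * q n x)).
  have [iq _] := integral_simple_scalar (fun j => l2ip (v n j) Z) (hE n).
  by apply: eq_integrable (integrableZl _ z^-1 iq).
have qcv : {ae mu, forall x, `[0, t]%classic x ->
    (fun n => z^-1 * q n x) @ \oo --> z^-1 * l2ip (f x) Z}.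
  move: hae; apply: (@filterS _ _ (ae_filter_ringOfSetsType mu)).
  move=> x hx xt; have {}hx := hx xt.
  apply/cvgrPdist_le => e e0.
  move/cvgrPdist_le : hx => /(_ e e0); apply: filterS => n.
  rewrite sub0r normrN => hn; rewrite -mulrBr normrM gtr0_norm ?invr_gt0//.
  rewrite distrC ler_pdivrMl//; apply: le_trans (qa n x (inD _ xt)) _.
  by rewrite ler_pM2l//; exact: le_trans (ler_norm _) hn.
have qa' n x : `[0, t]%classic x -> `|z^-1 * q n x - z^-1 * l2ip (f x) Z| <= a n x.
  move=> xt; rewrite -mulrBr normrM gtr0_norm ?invr_gt0// ler_pdivrMl//.
  exact: qa (inD _ xt).
have Icv : (fun n => \int[mu]_(x in `[0, t]) (z^-1 * q n x)) @ \oo -->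
    z^-1 * l2ip X Z.
  apply/cvgrPdist_le => e e0.
  move/cvgrPdist_le : hI => /(_ e e0); apply: filterS => n hn.
  have [iqn qn] := integral_simple_scalar (fun j => l2ip (v n j) Z) (hE n).
  rewrite RintegralZl// qn -l2ip_suml// -mulrBr normrM gtr0_norm ?invr_gt0//.
  rewrite ler_pdivrMl// distrC -l2ipBl//; last exact: fint.
  apply: le_trans (le1 _ (vnB vF (fint n) fX)) _.
  by rewrite ler_pM2l//; apply: le_trans (ler_norm _) _; rewrite sub0r normrN in hn.
have [||p [ip pe pI]] := L1_limit _ iq qcv qa' _ Icv.
- exact: measurable_itv.
- exact: hL1.
exists (fun x => z * p x); split.
- by apply: eq_integrable (integrableZl _ z ip).
- move: pe; apply: (@filterS _ _ (ae_filter_ringOfSetsType mu)).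
  by move=> x px xt; rewrite px// mulVKf// gt_eqF.
- by rewrite RintegralZl// pI mulVKf// gt_eqF.
Qed.

(** Pairing with the difference [Z] itself bounds [norm2 Z ^+ 2] by a scalar
    integral over [[t, t']], to which the Cauchy-Schwarz inequality applies
    pointwise. *)
Lemma bochner_frozen t t' f D D' Y K : 0 <= t -> t <= t' ->
  bochner_integral t f D -> bochner_integral t' f D' ->
  (forall x, 0 <= x <= t' -> vna F (f x)) -> vna F Y ->
  (forall x, t <= x <= t' -> norm2 (f x - Y) <= K) ->
  norm2 (D' - D - (t' - t)%:C *: Y) <= (t' - t) * K.
Proof.
move=> t0 tt' bD bD' ff fY hK.
have fD : vna F D by case: bD.
have fD' : vna F D' by case: bD'.
have fcY := vnZ vF (t' - t)%:C fY.
set Z := _ - _ *: _.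
have fDD := vnB vF fD' fD.
have fZ : vna F Z by exact: (vnB vF).
have ff0 x : 0 <= x <= t -> vna F (f x).
  by move=> /andP[x0 xt]; apply: ff; rewrite x0 (le_trans xt).
have [p [ip pe pI]] := bochner_scalar bD fZ ff0.
have [p' [ip' pe' pI']] := bochner_scalar bD' fZ ff.
have ip't : mu.-integrable `[0, t] (EFin \o p').
  apply: integrableS ip' => //; apply: subset_itvl; exact: tt'.
have eqp : \int[mu]_(x in `[0, t]) p x = \int[mu]_(x in `[0, t]) p' x.
  rewrite /Rintegral; congr fine; apply: ae_eq_integral => //.
  - exact: measurable_int ip.
  - exact: measurable_int ip't.
  - move: pe pe'; apply: (@filterS2 _ _ (ae_filter_ringOfSetsType mu)).
    move=> x h h' xt; rewrite h// h'//.
    by move: xt; rewrite /= !in_itv/= => /andP[-> /le_trans]; exact.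
have ip'' : mu.-integrable `]t, t'] (EFin \o p').
  apply: integrableS ip' => //; apply: subset_itvr; exact: t0.
have inc : l2ip (D' - D) Z = \int[mu]_(x in `]t, t']) p' x.
  by rewrite l2ipBl// -pI -pI' eqp; apply: Rintegral_itvB => //; rewrite bnd_simp.
pose k := l2ip Y Z + K * norm2 Z.
have muI : mu `]t, t'] = (t' - t)%:E.
  rewrite lebesgue_measure_itv/= lte_fin; case: ltP => // h.
  by rewrite (le_anti (introT andP (conj tt' h))) subrr.
have ck : mu.-integrable `]t, t'] (EFin \o (fun=> k)).
  apply: integrableS (_ : mu.-integrable `[t, t'] _) => //.
    by apply: subset_itv; rewrite bnd_simp.
  apply: continuous_compact_integrable; first exact: segment_compact.
  by apply: continuous_subspaceT => x; exact: cvg_cst.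
have ub : \int[mu]_(x in `]t, t']) p' x <= (t' - t) * k.
  (* the bound on [p'] holds almost everywhere: truncate at [k] *)
  pose g x := Num.min (p' x) k.
  have mp' : measurable_fun `]t, t'] p' by apply/measurable_EFinP; exact: measurable_int ip''.
  have mg : measurable_fun `]t, t'] g by exact: measurable_minr.
  have pg : {ae mu, forall x, `]t, t']%classic x -> p' x = g x}.
    move: pe'; apply: (@filterS _ _ (ae_filter_ringOfSetsType mu)) => x h.
    rewrite /= in_itv/= => /andP[tx xt'].
    have x0 : 0 <= x <= t' by rewrite xt' (le_trans t0 (ltW tx)).
    apply/esym/min_idPl; rewrite h; last by rewrite /= in_itv.
    have fx := ff x x0; have fxY := vnB vF fx fY.
    rewrite -(subrK Y (f x)) l2ipDl// addrC lerD2l.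
    apply: le_trans (l2_cauchy fxY fZ) _.
    by rewrite ler_wpM2r ?norm2_ge0// hK// xt' ltW.
  have ig : mu.-integrable `]t, t'] (EFin \o g).
    apply/integrableP; split; first exact/measurable_EFinP.
    have /integrableP[_] := ip''; congr (_ < _)%E; apply: ae_eq_integral => //.
    + by apply/measurable_EFinP; exact: measurableT_comp mp'.
    + by apply/measurable_EFinP; exact: measurableT_comp mg.
    + by move: pg; apply: (@filterS _ _ (ae_filter_ringOfSetsType mu)) => x h xt; rewrite /= h.
  have -> : \int[mu]_(x in `]t, t']) p' x = \int[mu]_(x in `]t, t']) g x.
    rewrite /Rintegral; congr fine; apply: ae_eq_integral => //.
    + exact/measurable_EFinP.
    + exact/measurable_EFinP.
    + by move: pg; apply: (@filterS _ _ (ae_filter_ringOfSetsType mu)) => x h xt; rewrite h.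
  apply: le_trans (le_Rintegral _ ig ck _) _ => //.
    by move=> x _; rewrite ge_min lexx orbT.
  by rewrite Rintegral_cst//= muI mulrC.
have nZ : norm2 Z ^+ 2 <= (t' - t) * K * norm2 Z.
  rewrite sqr_norm2// {1}/Z l2ipBl// inc l2ipZl//.
  move: ub; rewrite /k; lra.
have [z0|z0] := eqVneq (norm2 Z) 0.
  rewrite z0 mulr_ge0 ?subr_ge0//; apply: le_trans (norm2_ge0 _) (hK t _).
  by rewrite lexx.
by rewrite -(@ler_pM2r _ (norm2 Z)) -?expr2// lt_def z0 norm2_ge0.
Qed.

End Bochner.

(** * Error recursion of the theta scheme *)

Section DiscreteGronwall.
Context {R : realType}.
Implicit Types h s e p N G C L : R.

(** Here [s] is the square root of the step, [e] and [e'] are the errors before and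
    after the step, [N] is the noise error, orthogonal to the previous error (hence
    the Pythagorean hypothesis), and [G] is the drift error. The drift is only
    bounded, without orthogonality, and is absorbed by the Young inequality
    [2 p G <= h p^2 + G^2 / h]; this costs no more than a factor [1 + h] since
    [G] carries the full power of [h]. *)
Lemma mean_square_step h s e e' p N G C2 C3 : s ^+ 2 = h -> 0 < s -> s <= 1 ->
  0 <= e -> 0 <= e' -> 0 <= p -> 0 <= N -> 0 <= G -> 0 <= C2 -> 0 <= C3 ->
  e' <= p + G -> p ^+ 2 = e ^+ 2 + N ^+ 2 ->
  N <= C2 * (s * (s + e)) -> G <= C3 * (h * (s + e + e')) ->
  e' ^+ 2 <= e ^+ 2 + (1 + 4 * C2 ^+ 2 + 6 * C3 ^+ 2) * h * (h + e ^+ 2 + e' ^+ 2).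
Proof.
move=> sh s0 s1 e0 e'0 p0 N0 G0 C20 C30 h1 h2 h3 h4.
have hp : 0 < h by rewrite -sh exprn_gt0.
have hle1 : h <= 1 by rewrite -sh expr_le1// ltW.
have N2 : N ^+ 2 <= C2 ^+ 2 * (h * (2 * (h + e ^+ 2))).
  apply: le_trans (_ : (C2 * (s * (s + e))) ^+ 2 <= _).
    by rewrite ler_pXn2r ?nnegrE// ?mulr_ge0// ?addr_ge0// ltW.
  rewrite !exprMn sh ler_wpM2l ?sqr_ge0// ler_pM2l// -sh.
  have := sqr_ge0 (s - e); nra.
have G2 : G ^+ 2 <= C3 ^+ 2 * (h ^+ 2 * (3 * (h + e ^+ 2 + e' ^+ 2))).
  apply: le_trans (_ : (C3 * (h * (s + e + e'))) ^+ 2 <= _).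
    by rewrite ler_pXn2r ?nnegrE// ?mulr_ge0// ?addr_ge0// ltW.
  rewrite !exprMn ler_wpM2l ?sqr_ge0// ler_pM2l ?exprn_gt0// -sh.
  have := sqr_ge0 (s - e); have := sqr_ge0 (s - e'); have := sqr_ge0 (e - e'); nra.
have young : 2 * (p * G) <= h * p ^+ 2 + G ^+ 2 / h.
  rewrite -(ler_pM2l hp) mulrDr [h * (_ / _)]mulrCA divff ?gt_eqF// mulr1.
  have := sqr_ge0 (h * p - G); nra.
have e2 : e' ^+ 2 <= (p + G) ^+ 2 by rewrite ler_pXn2r ?nnegrE ?addr_ge0.
set S := h + e ^+ 2 + e' ^+ 2 in G2 *.
have S0 : 0 <= S by rewrite /S !addr_ge0 ?sqr_ge0// ltW.
have G3 : G ^+ 2 / h <= 3 * C3 ^+ 2 * h * S.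
  rewrite ler_pdivrMr//; apply: le_trans G2 _; nra.
have G4 : G ^+ 2 <= 3 * C3 ^+ 2 * h * S.
  apply: le_trans G2 _; rewrite -subr_ge0.
  have : 0 <= C3 ^+ 2 * S * h * (1 - h) by rewrite !mulr_ge0 ?sqr_ge0 ?subr_ge0// ltW.
  nra.
have pe : h * p ^+ 2 <= h * e ^+ 2 + N ^+ 2.
  rewrite h2 mulrDr lerD2l ler_piMl ?sqr_ge0//.
have N3 : N ^+ 2 <= 2 * C2 ^+ 2 * h * S.
  apply: le_trans N2 _; rewrite -subr_ge0.
  have : 0 <= C2 ^+ 2 * h * e' ^+ 2 by rewrite !mulr_ge0 ?sqr_ge0// ltW.
  rewrite /S; nra.
have eS : h * e ^+ 2 <= h * S.
  rewrite ler_pM2l// /S; have := sqr_ge0 e'; lra.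
nra.
Qed.

(** The recursion is only available while the error stays below [1]. As the bound
    it yields is itself at most [1] for a small step, an induction keeps the error
    in the range where the recursion holds. *)
Lemma bootstrapped_gronwall (h L : R) (P : nat) (x : nat -> R) :
  0 <= h -> 0 <= L -> L * h <= 2^-1 ->
  expR (4 * (L * h)) ^+ P * h <= 1 ->
  x 0%N = 0 -> (forall n, (n <= P)%N -> 0 <= x n) ->
  (forall n, (n < P)%N -> x n <= 1 ->
    x n.+1 ^+ 2 <= x n ^+ 2 + L * h * (h + x n ^+ 2 + x n.+1 ^+ 2)) ->
  forall n, (n <= P)%N -> x n ^+ 2 <= expR (4 * (L * h)) ^+ P * h.
Proof.
move=> h0 L0 Lh E1 x0 xge step.
set q := L * h in Lh E1 step *; have q0 : 0 <= q by exact: mulr_ge0.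
clearbody q; have hE := expR_ge1Dx (4 * q); set E := expR _ in hE E1 *.
have E1' : 1 <= E by apply: le_trans hE; lra.
have mon n : (n <= P)%N -> E ^+ n * h <= E ^+ P * h.
  by move=> nP; rewrite ler_wpM2r// ler_weXn2l.
suff key n : (n <= P)%N -> x n ^+ 2 + h <= E ^+ n * h.
  by move=> n nP; apply: le_trans (mon n nP); apply: le_trans (key n nP); rewrite lerDl.
elim: n => [|n IH] nP; first by rewrite x0 expr0n/= add0r expr0 mul1r.
have hn := IH (ltnW nP).
have xn1 : x n <= 1.
  rewrite -(@expr_le1 _ 2)//; last by apply: xge; exact: ltnW.
  by apply: le_trans E1; apply: le_trans (mon n (ltnW nP)); apply: le_trans hn; rewrite lerDl.
have := step n nP xn1.
set y := x n ^+ 2 in hn *; set z := x n.+1 ^+ 2 => hz.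
have y0 : 0 <= y by exact: sqr_ge0.
have z0 : 0 <= z by exact: sqr_ge0.
clearbody y z.
have : z + h <= (1 + 4 * q) * (y + h).
  have q1 : 0 < 1 - q by lra.
  (* (1 - q) (1 + 4 q) - (1 + q) = 2 q (1 - 2 q) *)
  have : 0 <= 2 * q * (1 - 2 * q) * (y + h).
    by apply: mulr_ge0; [apply: mulr_ge0; lra|exact: addr_ge0].
  have : 0 <= q * h by exact: mulr_ge0.
  rewrite -(ler_pM2l q1); nra.
move=> /le_trans; apply; rewrite exprS -mulrA.
by apply: ler_pM => //; lra.
Qed.

End DiscreteGronwall.

Section ThetaScheme.
Local Open Scope complex_scope.
Context {R : realType} {F : ncProbSpace R} (W : R -> F -> F).
Hypothesis hW : free_brownian W.
Local Notation op := (F -> F).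
Implicit Types (X Y Z V : op).

Let vF := vna_von_neumann F.

Lemma vna_sa0 : @vna_sa R F 0.
Proof.
split; first exact: (vn0 vF).
have e z : (0 : op) z = 0 by [].
by move=> x y; rewrite !e linear0l linear0r.
Qed.

Lemma norm2_convex (a : R) X Y V (r1 r2 : R) : 0 <= a <= 1 ->
  vna F X -> vna F Y -> vna F V -> norm2 (V - X) <= r1 -> norm2 (V - Y) <= r2 ->
  norm2 (V - ((1 - a)%:C *: X + a%:C *: Y)) <= r1 + r2.
Proof.
move=> /andP[a0 a1] fX fY fV h1 h2.
have fVX := vnB vF fV fX; have fVY := vnB vF fV fY.
have -> : V - ((1 - a)%:C *: X + a%:C *: Y) =
    (1 - a)%:C *: (V - X) + a%:C *: (V - Y).
  rewrite !scalerBr addrACA -scalerDl -rmorphD subrK rmorph1 scale1r.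
  by rewrite opprD.
apply: le_trans (norm2D _ _) _; [exact: (vnZ vF)|exact: (vnZ vF)|].
rewrite !norm2Z// ger0_norm ?subr_ge0// ger0_norm// lerD//.
  apply: le_trans h1; rewrite ler_piMl ?norm2_ge0//; lra.
by apply: le_trans h2; rewrite ler_piMl ?norm2_ge0.
Qed.

Lemma uniform_local_lipschitz k (f : 'I_k -> op -> op) (M : R) : 0 < M ->
  (forall i, L2_locally_lipschitz (f i)) ->
  exists2 L : R, 0 <= L & forall i,
    (forall X Y, vna_sa X -> vna_sa Y -> norm2 X <= M -> norm2 Y <= M ->
       norm2 (f i X - f i Y) <= L * norm2 (X - Y)).
Proof.
move=> M0 fl.
have /choice[l hl] : forall i, exists L : R, 0 < L /\
    forall X Y, vna_sa X -> vna_sa Y -> norm2 X <= M -> norm2 Y <= M ->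
      norm2 (f i X - f i Y) <= L * norm2 (X - Y).
  by move=> i; have [L L0 hL] := fl i M M0; exists L.
have l0 i : 0 <= l i by case: (hl i) => /ltW.
exists (\sum_i l i) => [|i X Y sX sY nX nY]; first exact: sumr_ge0.
apply: le_trans ((hl i).2 X Y sX sY nX nY) _.
by rewrite ler_wpM2r ?norm2_ge0// (bigD1 i)//= lerDl sumr_ge0.
Qed.

Lemma uniform_bound k (f : 'I_k -> op -> op) (M L : R) : 0 <= M ->
  (forall i X, vna_sa X -> vna_sa (f i X)) ->
  (forall i, (forall X Y, vna_sa X -> vna_sa Y -> norm2 X <= M -> norm2 Y <= M ->
       norm2 (f i X - f i Y) <= L * norm2 (X - Y))) -> 0 <= L ->
  exists2 K : R, 0 <= K & forall i X, vna_sa X -> norm2 X <= M -> norm2 (f i X) <= K.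
Proof.
move=> M0 fsa fl L0; exists (\sum_i norm2 (f i 0) + L * M).
  by rewrite addr_ge0 ?mulr_ge0// sumr_ge0// => i _; exact: norm2_ge0.
move=> i X sX nX; have [fX _] := fsa i X sX; have [f0 _] := fsa i _ vna_sa0.
apply: le_trans (norm2_le_dist fX f0) _; apply: lerD.
  by rewrite (bigD1 i)//= lerDl sumr_ge0// => j _; exact: norm2_ge0.
apply: le_trans (fl i X 0 sX vna_sa0 nX _) _; first by rewrite norm2_0.
by rewrite subr0 ler_wpM2l.
Qed.

Section OneStep.
Variables (T theta : R) (k : nat) (U0 : op).
Variables (alpha : op -> op) (beta gamma : 'I_k -> op -> op) (U : R -> op).
Hypotheses (T0 : 0 < T) (htheta : 0 <= theta <= 1).
Hypothesis alpha_sa : forall X, vna_sa X -> vna_sa (alpha X).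
Hypothesis beta_sa : forall i X, vna_sa X -> vna_sa (beta i X).
Hypothesis gamma_sa : forall i X, vna_sa X -> vna_sa (gamma i X).
Hypothesis beta_ad : forall i, coef_adapted W (beta i).
Hypothesis gamma_ad : forall i, coef_adapted W (gamma i).
Hypothesis hU : fsde_solution W alpha beta gamma T U0 U.
Variables (M LA L K KA : R).
Hypotheses (LA0 : 0 <= LA) (L0 : 0 <= L) (K0 : 0 <= K).
Hypothesis U_le : forall t : R, 0 <= t <= T -> norm2 (U t) <= M.
Hypothesis alpha_lip : forall X Y, vna_sa X -> vna_sa Y ->
  norm2 (alpha X - alpha Y) <= LA * norm2 (X - Y).
Hypothesis alpha_le : forall t : R, 0 <= t <= T -> norm2 (alpha (U t)) <= KA.
Hypothesis beta_lip : forall i X Y, vna_sa X -> vna_sa Y -> norm2 X <= M + 1 ->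
  norm2 Y <= M + 1 -> norm2 (beta i X - beta i Y) <= L * norm2 (X - Y).
Hypothesis gamma_lip : forall i X Y, vna_sa X -> vna_sa Y -> norm2 X <= M + 1 ->
  norm2 Y <= M + 1 -> norm2 (gamma i X - gamma i Y) <= L * norm2 (X - Y).
Hypothesis beta_le : forall i X, vna_sa X -> norm2 X <= M + 1 -> norm2 (beta i X) <= K.
Hypothesis gamma_le : forall i X, vna_sa X -> norm2 X <= M + 1 -> norm2 (gamma i X) <= K.

Lemma U_sa t : 0 <= t <= T -> vna_sa (U t).
Proof. by move=> ht; have [|? _] := fsde_adapted hU (t := t); rewrite ?in_itv. Qed.

Lemma U_ad t : 0 <= t <= T -> filtration W t (U t).
Proof. by move=> ht; have [|_ ?] := fsde_adapted hU (t := t); rewrite ?in_itv. Qed.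

Lemma U_le1 t : 0 <= t <= T -> norm2 (U t) <= M + 1.
Proof. by move=> ht; have := U_le ht; lra. Qed.

Lemma coef_adapted_sa (f : op -> op) t : t <= T -> coef_adapted W f ->
  (forall X, vna_sa X -> vna_sa (f X)) -> adapted_sa W (fun s => f (U s)) 0 t.
Proof.
move=> tT f_ad fsa s /andP[s0 st]; have hs : 0 <= s <= T by rewrite s0 (le_trans st).
have [_ sf] := fsa _ (U_sa hs); split => //.
by apply: f_ad => //; [exact: U_sa|exact: U_ad].
Qed.

(** The frozen coefficients are left free, since two choices matter: zero for the
    time regularity of the solution, and the coefficients of the scheme for the
    error of one step. *)
Lemma solution_increment t t' Y (B C : 'I_k -> op) (KD K1 K2 : R) :
  0 <= t -> t <= t' -> t' <= T ->
  vna F Y -> (forall i, filtration W t (B i) /\ selfadjoint (B i)) ->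
  (forall i, filtration W t (C i) /\ selfadjoint (C i)) ->
  (forall r, t <= r <= t' -> norm2 (alpha (U r) - Y) <= KD) ->
  (forall i r, t <= r <= t' ->
     norm2 (beta i (U r) - B i) * norm2 (gamma i (U r)) <= K1) ->
  (forall i r, t <= r <= t' -> norm2 (B i) * norm2 (gamma i (U r) - C i) <= K2) ->
  exists (G : op) (X : 'I_k -> op),
   [/\ U t' - U t = (t' - t)%:C *: Y + \sum_i (B i \o (W t' - W t) \o C i)
                     + G + \sum_i X i,
      vna F G /\ (forall i, vna F (X i)),
      norm2 G <= (t' - t) * KD,
      forall i, norm2 (X i) <= 4 * Num.sqrt (t' - t) * (K1 + K2) &
      forall i Z, filtration W t Z -> l2ip Z (X i) = 0].
Proof.
move=> t0 tt' t'T fY hB hC hKD hK1 hK2.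
have [|D [N [bD iN eU]]] := fsde_eq hU (t := t).
  by rewrite in_itv/= t0 (le_trans tt').
have [|D' [N' [bD' iN' eU']]] := fsde_eq hU (t := t').
  by rewrite in_itv/= t'T (le_trans t0).
have fD : vna F D by case: bD.
have fD' : vna F D' by case: bD'.
have fN i : vna F (N i) by case: (iN i).
have fN' i : vna F (N' i) by case: (iN' i).
have fw := vna_dW hW t0 tt'.
have fBC i : vna F (B i \o (W t' - W t) \o C i).
  have [/(filtration_sub hW) fB _] := hB i; have [/(filtration_sub hW) fC _] := hC i.
  by apply: (vn_mul vF) => //; exact: (vn_mul vF).
have fr i := free_integral_frozen hW t0 tt' (coef_adapted_sa t'T (beta_ad i) (beta_sa i))
  (coef_adapted_sa t'T (gamma_ad i) (gamma_sa i)) (iN i) (iN' i)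
  (hB i).1 (hB i).2 (hC i).1 (hC i).2 (hK1 i) (hK2 i).
exists (D' - D - (t' - t)%:C *: Y),
  (fun i => N' i - N i - (B i \o (W t' - W t) \o C i)); split.
- rewrite eU eU' !sumrB.
  set S' := \sum_i N' i; set S := \sum_i N i; set E := \sum_i (_ \o _).
  set y := _ *: Y.
  rewrite opprD addrACA [- (U0 + D)]opprD (addrACA U0) subrr add0r.
  rewrite (addrAC y E) (addrC y) subrK -(addrA (D' - D)).
  by rewrite (addrC E) subrK.
- by split=> [|i]; do ![apply: (vnB vF) => //]; exact: (vnZ vF).
- apply: (bochner_frozen t0 tt' bD bD') => // x /andP[x0 xt'].
  by have [|] := alpha_sa (U_sa (t := x) _); rewrite ?x0 ?(le_trans xt').
- by move=> i; have [] := fr i.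
- by move=> i; have [] := fr i.
Qed.

(** With vanishing frozen coefficients the increment itself is estimated; the noise
    gives the square root and the drift a full power of the time step. *)
Lemma solution_holder : exists2 C1 : R, 0 <= C1 &
  forall s t : R, 0 <= s -> s <= t -> t <= T ->
    norm2 (U t - U s) <= C1 * Num.sqrt (t - s).
Proof.
have KA0 : 0 <= KA.
  by apply: le_trans (norm2_ge0 _) (alpha_le (t := 0) _); rewrite lexx ltW.
exists (Num.sqrt T * KA + 4 * K ^+ 2 *+ k).
  by rewrite addr_ge0 ?mulr_ge0 ?sqrtr_ge0// mulrn_wge0// mulr_ge0// sqr_ge0.
move=> s t s0 st tT.
have f0 : vna F 0 by exact: (vn0 vF).
have h0 : filtration W s 0 by exact: (vn0 (filtration_vn hW s)).
have sa0 : selfadjoint (0 : op) by case: vna_sa0.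
have rT r : s <= r <= t -> 0 <= r <= T.
  by move=> /andP[sr rt]; rewrite (le_trans s0 sr) (le_trans rt).
have [|||G [X [-> [fG fX] nG nX _]]] := @solution_increment s t 0 (fun=> 0) (fun=> 0)
    KA (K ^+ 2) 0 s0 st tT f0 (fun=> conj h0 sa0) (fun=> conj h0 sa0).
- by move=> r /rT hr; rewrite subr0; exact: alpha_le.
- move=> i r /rT hr; rewrite subr0 expr2.
  have sU := U_sa hr; have nU := U_le1 hr.
  by rewrite ler_pM ?norm2_ge0 ?beta_le ?gamma_le.
- by move=> i r _; rewrite norm2_0 mul0r.
rewrite scaler0 add0r big1 ?add0r => [|i _]; last first.
  by apply/funext => x; rewrite /= fctE.
have fS : vna F (\sum_i X i) by exact: (vn_sum vF).
apply: le_trans (norm2D fG fS) _; rewrite mulrDl; apply: lerD.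
  apply: le_trans nG _; rewrite mulrAC ler_wpM2r//.
  rewrite -{1}(@sqr_sqrtr _ (t - s)) ?subr_ge0// expr2 ler_wpM2r ?sqrtr_ge0//.
  by rewrite ler_wsqrtr//; lra.
apply: le_trans (norm2_sum _ _) _ => //.
apply: le_trans (ler_sum _ (fun i _ => nX i)) _.
rewrite sumr_const card_ord addr0 -!(mulr_natr (_ * _) k) le_eqVlt.
by apply/orP; left; apply/eqP; ring.
Qed.

Variable P : nat.
Hypothesis P0 : (0 < P)%N.
Variable Ub : nat -> op.
Hypothesis hUb : theta_scheme W alpha beta gamma T U0 theta P Ub.

Local Notation h := (step T P).
Local Notation err n := (norm2 (U (grid T P n) - Ub n)).

Lemma step_gt0 : 0 < h.
Proof. by rewrite divr_gt0// ltr0n. Qed.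

Lemma grid_le n : (n <= P)%N -> 0 <= grid T P n <= T.
Proof.
move=> nP; rewrite /grid mulr_ge0 ?(ltW step_gt0)//=.
by rewrite /step mulrA ler_pdivrMr ?ltr0n// mulrC ler_pM2l// ler_nat.
Qed.

Lemma gridS n : grid T P n.+1 - grid T P n = h.
Proof. by rewrite /grid -mulrBl -natrB// subSnn mul1r. Qed.

(** One step of the scheme, with its coefficients at [Ub n] as frozen coefficients.
    The noise errors are orthogonal to the previous error, so that their squares
    add up instead of their norms: this is where the order [1/2] is gained. The
    assumption [err n <= 1] places [Ub n] in the ball of radius [M + 1], on which
    the local Lipschitz constants are available; the implicit term only involves
    the globally Lipschitz drift, so the step applies before [Ub n.+1] is known to
    lie in that ball. *)
Lemma error_step C1 n : 0 <= C1 ->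
  (forall s t : R, 0 <= s -> s <= t -> t <= T ->
    norm2 (U t - U s) <= C1 * Num.sqrt (t - s)) ->
  h <= 1 -> (n < P)%N -> err n <= 1 ->
  err n.+1 ^+ 2 <= err n ^+ 2 +
    (1 + 4 * ((8 * (L * K) *+ k) * (C1 + 1)) ^+ 2 + 6 * (2 * LA * (C1 + 1)) ^+ 2)
      * h * (h + err n ^+ 2 + err n.+1 ^+ 2).
Proof.
move=> C10 hC1 h1 nP en1.
have h0 := step_gt0.
have /andP[t0 tT] := grid_le (ltnW nP); have /andP[t'0 t'T] := grid_le nP.
have tt'h := gridS n.
set t := grid T P n in t0 tT tt'h en1 *; set t' := grid T P n.+1 in t'0 t'T tt'h *.
have tt' : t <= t' by rewrite -subr_ge0 tt'h ltW.
set b := Ub n in en1 *; set b' := Ub n.+1.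
have sb : vna_sa b by apply: (scheme_sa hUb); exact: ltnW.
have sb' : vna_sa b' by exact: (scheme_sa hUb).
have adb : filtration W t b by apply: (scheme_adapted hUb); exact: ltnW.
have sUt : vna_sa (U t) by apply: U_sa; rewrite t0.
have sUt' : vna_sa (U t') by apply: U_sa; rewrite t'0.
have fb := sb.1; have fb' := sb'.1; have fU := sUt.1; have fU' := sUt'.1.
have nb : norm2 b <= M + 1.
  have := norm2_le_dist fb fU; rewrite norm2_sub//.
  have := @U_le t; rewrite t0 tT => /(_ isT); lra.
set e := norm2 (U t - b) in en1 *; set e' := norm2 (U t' - b').
have e0 : 0 <= e := norm2_ge0 _; have e'0 : 0 <= e' := norm2_ge0 _.
set s := Num.sqrt h.
have sh : s ^+ 2 = h by rewrite sqr_sqrtr// ltW.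
have s0 : 0 < s by rewrite sqrtr_gt0.
have s1 : s <= 1 by rewrite -(@expr_le1 _ 2)// ?sh// ltW.
have rT r : t <= r <= t' -> 0 <= r <= T.
  by move=> /andP[tr rt]; rewrite (le_trans t0 tr) (le_trans rt).
have sr (x : R) : x <= h -> C1 * Num.sqrt x <= C1 * s.
  by move=> xh; rewrite ler_wpM2l// ler_wsqrtr.
have dl r : t <= r <= t' -> norm2 (U r - b) <= C1 * s + e.
  move=> hr; have hr' := rT r hr; have [fUr _] := U_sa hr'.
  apply: le_trans (norm2_tri fUr fb fU) _; rewrite lerD2r.
  have /andP[tr rt] := hr.
  apply: le_trans (hC1 t r t0 tr _) _; first by case/andP: hr'.
  by apply: sr; rewrite -tt'h lerD2r.
have dr r : t <= r <= t' -> norm2 (U r - b') <= C1 * s + e'.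
  move=> hr; have hr' := rT r hr; have [fUr _] := U_sa hr'.
  apply: le_trans (norm2_tri fUr fb' fU') _; rewrite lerD2r norm2_sub//.
  have /andP[tr rt] := hr.
  apply: le_trans (hC1 r t' _ rt t'T) _; first by case/andP: hr'.
  by apply: sr; rewrite -tt'h lerD2l lerN2.
have [fab _] := alpha_sa sb; have [fab' _] := alpha_sa sb'.
pose Y := (1 - theta)%:C *: alpha b + theta%:C *: alpha b'.
have fY : vna F Y by apply: (vnD vF); exact: (vnZ vF).
have co (f : op -> op) : coef_adapted W f -> (forall X, vna_sa X -> vna_sa (f X)) ->
    filtration W t (f b) /\ selfadjoint (f b).
  by move=> f_ad fsa; split; [exact: f_ad|case: (fsa b sb)].
have KD0 : 0 <= C1 * s + e by rewrite addr_ge0// mulr_ge0// ltW.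
have KD0' : 0 <= C1 * s + e' by rewrite addr_ge0// mulr_ge0// ltW.
have [|||G [X [eq_inc [fG fX] nG nX oX]]] := @solution_increment t t' Y
    (fun i => beta i b) (fun i => gamma i b)
    (LA * (C1 * s + e) + LA * (C1 * s + e')) (L * (C1 * s + e) * K)
    (K * (L * (C1 * s + e))) t0 tt' t'T fY
    (fun i => co _ (beta_ad i) (beta_sa i)) (fun i => co _ (gamma_ad i) (gamma_sa i)).
- move=> r hr; have hr' := rT r hr; have sUr := U_sa hr'.
  have [fa _] := alpha_sa sUr.
  apply: norm2_convex => //.
    by apply: le_trans (alpha_lip sUr sb) _; rewrite ler_wpM2l// dl.
  by apply: le_trans (alpha_lip sUr sb') _; rewrite ler_wpM2l// dr.
- move=> i r hr; have hr' := rT r hr; have sUr := U_sa hr'; have nUr := U_le1 hr'.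
  rewrite ler_pM ?norm2_ge0 ?gamma_le//.
  by apply: le_trans (beta_lip i sUr sb nUr nb) _; rewrite ler_wpM2l// dl.
- move=> i r hr; have hr' := rT r hr; have sUr := U_sa hr'; have nUr := U_le1 hr'.
  rewrite ler_pM ?norm2_ge0 ?beta_le//.
  by apply: le_trans (gamma_lip i sUr sb nUr nb) _; rewrite ler_wpM2l// dl.
have fS : vna F (\sum_i X i) by exact: (vn_sum vF).
have fe : vna F (U t - b) by exact: (vnB vF).
have he : filtration W t (U t - b).
  by apply: (vnB (filtration_vn hW t)) => //; apply: U_ad; rewrite t0.
set Q := U t - b + \sum_i X i.
have fQ : vna F Q by exact: (vnD vF).
have e'E : U t' - b' = Q + G.
  have := scheme_eq hUb nP; rewrite -/b -/b' -/t => ->.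
  have -> : U t' = (U t' - U t) + U t by rewrite subrK.
  rewrite eq_inc /noise -/t -/t' -/b tt'h.
  have -> : h%:C *: Y = ((1 - theta) * h)%:C *: alpha b + (theta * h)%:C *: alpha b'.
    by rewrite /Y scalerDr !scalerA -!rmorphM ![h * _]mulrC.
  set w := _ *: _ + _ *: _; set N := \sum_i (_ \o _); set S := \sum_i X i.
  rewrite -(addrA b) -/w -(addrA b) -!(addrA (w + N)) opprD.
  rewrite [- b + _]addrC addrCA (addrA (w + N)) subrr add0r.
  by rewrite /Q -/S -addrA addrC [G + S]addrC addrA.
apply: (@mean_square_step _ h s e e' (norm2 Q) (norm2 (\sum_i X i)) (norm2 G)) => //.
- exact: norm2_ge0.
- exact: norm2_ge0.
- exact: norm2_ge0.
- by rewrite mulr_ge0 ?addr_ge0// mulrn_wge0// !mulr_ge0.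
- by rewrite !mulr_ge0 ?addr_ge0.
- by rewrite /e' e'E norm2D.
- by rewrite sqr_norm2D// l2ip_sumr// big1 ?mulr0 ?addr0// => i _; exact: oX.
- apply: le_trans (norm2_sum _ _) _ => //.
  apply: le_trans (ler_sum _ (fun i _ => nX i)) _.
  rewrite sumr_const card_ord tt'h -/s -!(mulr_natr (_ * _) k) -subr_ge0.
  have -> : 8 * (L * K) * k%:R * (C1 + 1) * (s * (s + e)) -
      4 * s * (L * (C1 * s + e) * K + K * (L * (C1 * s + e))) * k%:R =
      8 * (L * K * s * (s + C1 * e) * k%:R) by ring.
  by rewrite !mulr_ge0 ?addr_ge0 ?mulr_ge0// ltW.
- apply: le_trans nG _; rewrite tt'h -subr_ge0.
  have -> : 2 * LA * (C1 + 1) * (h * (s + e + e')) -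
      h * (LA * (C1 * s + e) + LA * (C1 * s + e')) =
      h * LA * (2 * s + (2 * C1 + 1) * (e + e')) by ring.
  by rewrite !mulr_ge0 ?addr_ge0 ?mulr_ge0 ?addr_ge0 ?mulr_ge0// ltW.
Qed.

End OneStep.
End ThetaScheme.

(** * Convergence of the theta scheme *)

Unset Implicit Arguments.
Set Strict Implicit.
Set Printing Implicit Defensive.

Theorem theorem3 (R : realType) (F : ncProbSpace R) (W : R -> F -> F)
    (T theta : R) (k : nat) (U0 : F -> F)
    (alpha : (F -> F) -> (F -> F)) (beta gamma : 'I_k -> (F -> F) -> (F -> F))
    (U : R -> F -> F) (Ps : set nat) (Ub : nat -> nat -> F -> F)
    (hW : free_brownian W)
    (hT : 0 < T) (htheta : 0 <= theta <= 1)
    (hU0 : vna_sa U0)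
    (halpha : forall X, vna_sa X -> vna_sa (alpha X))
    (hbeta : forall i X, vna_sa X -> vna_sa (beta i X))
    (hgamma : forall i X, vna_sa X -> vna_sa (gamma i X))
    (halpha_ad : coef_adapted W alpha)
    (hbeta_ad : forall i, coef_adapted W (beta i))
    (hgamma_ad : forall i, coef_adapted W (gamma i))
    (hU : fsde_unique_solution W alpha beta gamma T U0 U)
    (hU_bnd : exists M : R, forall t, t \in `[0, T] -> opnorm (U t) <= M)
    (hPs : forall P, Ps P -> (0 < P)%N)
    (hUb : forall P, Ps P ->
      theta_scheme_unique W alpha beta gamma T U0 theta P (Ub P))
    (hnoise : forall P n, Ps P -> (n < P)%N ->
      selfadjoint (noise W beta gamma T P (Ub P) n))
    (halpha_lip : L2_lipschitz alpha)
    (hbeta_lip : forall i, L2_locally_lipschitz (beta i))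
    (hgamma_lip : forall i, L2_locally_lipschitz (gamma i)) :
  (exists2 A' : R, 0 < A' & exists2 h0 : R, 0 < h0 &
     forall P, Ps P -> step T P <= h0 ->
       forall n, (n <= P)%N -> norm2 (Ub P n) ^+ 2 <= A') /\
  (exists2 C : R, 0 < C & exists2 h0 : R, 0 < h0 &
     forall P, Ps P -> step T P <= h0 ->
       forall n, (n <= P)%N ->
         norm2 (U (grid T P n) - Ub P n) <= C * Num.sqrt (step T P)).
Proof.
have [hsol _] := hU.
have [M0 hM0] := hU_bnd.
set M := Num.max M0 0.
have Mge0 : 0 <= M by rewrite le_max lexx orbT.
have M1 : 0 < M + 1 by rewrite ltr_wpDl.
have U_le t : 0 <= t <= T -> norm2 (U t) <= M.
  move=> ht; have [fU _] := U_sa hsol ht.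
  apply: le_trans (norm2_le_opnorm fU) _; rewrite le_max.
  by rewrite hM0 ?in_itv.
have [LA LA0 hLA] := halpha_lip.
have [Lb Lb0 hLb] := uniform_local_lipschitz M1 hbeta_lip.
have [Lg Lg0 hLg] := uniform_local_lipschitz M1 hgamma_lip.
have [Kb Kb0 hKb] := uniform_bound (ltW M1) hbeta hLb Lb0.
have [Kg Kg0 hKg] := uniform_bound (ltW M1) hgamma hLg Lg0.
pose L := Lb + Lg; pose K := Kb + Kg.
have L0 : 0 <= L by exact: addr_ge0.
have K0 : 0 <= K by exact: addr_ge0.
have bl i X Y : vna_sa X -> vna_sa Y -> norm2 X <= M + 1 -> norm2 Y <= M + 1 ->
    norm2 (beta i X - beta i Y) <= L * norm2 (X - Y).
  move=> sX sY nX nY; apply: le_trans (hLb i X Y sX sY nX nY) _.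
  by rewrite ler_wpM2r ?norm2_ge0// lerDl.
have gl i X Y : vna_sa X -> vna_sa Y -> norm2 X <= M + 1 -> norm2 Y <= M + 1 ->
    norm2 (gamma i X - gamma i Y) <= L * norm2 (X - Y).
  move=> sX sY nX nY; apply: le_trans (hLg i X Y sX sY nX nY) _.
  by rewrite ler_wpM2r ?norm2_ge0// lerDr.
have bb i X : vna_sa X -> norm2 X <= M + 1 -> norm2 (beta i X) <= K.
  by move=> sX nX; apply: le_trans (hKb i X sX nX) _; rewrite lerDl.
have gb i X : vna_sa X -> norm2 X <= M + 1 -> norm2 (gamma i X) <= K.
  by move=> sX nX; apply: le_trans (hKg i X sX nX) _; rewrite lerDr.
have ab t : 0 <= t <= T -> norm2 (alpha (U t)) <= norm2 (alpha 0) + LA * M.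
  move=> ht; have sU := U_sa hsol ht.
  have [fa _] := halpha _ sU; have [fa0 _] := halpha _ vna_sa0.
  apply: le_trans (norm2_le_dist fa fa0) _; rewrite lerD2l.
  apply: le_trans (hLA _ _ sU vna_sa0) _.
  by rewrite subr0 ler_wpM2l ?U_le// ltW.
have [C1 C10 hC1] := solution_holder hW hT halpha hbeta hgamma hbeta_ad hgamma_ad
  hsol U_le ab bb gb.
pose Lam := 1 + 4 * ((8 * (L * K) *+ k) * (C1 + 1)) ^+ 2
  + 6 * (2 * LA * (C1 + 1)) ^+ 2.
have Lam0 : 0 < Lam.
  by rewrite /Lam -addrA ltr_pwDl// addr_ge0// mulr_ge0// sqr_ge0.
pose E := expR (4 * (Lam * T)).
have E0 : 0 < E by exact: expR_gt0.
pose h0 := Num.min 1 (Num.min (2 * Lam)^-1 E^-1).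
have h00 : 0 < h0 by rewrite !lt_min ltr01 !invr_gt0 mulr_gt0.
have main P : Ps P -> step T P <= h0 -> forall n, (n <= P)%N ->
    norm2 (U (grid T P n) - Ub P n) ^+ 2 <= E * step T P /\ E * step T P <= 1.
  move=> hP; rewrite !le_min => /and3P[h1 h2 h3] n nP.
  have P0 := hPs P hP; have [sch _] := hUb P hP.
  have hp := step_gt0 hT P0.
  have Eh : E * step T P <= 1 by rewrite mulrC -ler_pdivlMr// mul1r.
  have EP : expR (4 * (Lam * step T P)) ^+ P = E.
    rewrite -expRM_natl; congr expR; rewrite /step.
    have : P%:R != 0 :> R by rewrite pnatr_eq0 -lt0n.
    by move=> P'; field.
  split=> //; rewrite -EP.
  apply: (bootstrapped_gronwall (x := fun n => norm2 (U (grid T P n) - Ub P n))) => //.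
  - exact: ltW.
  - exact: ltW.
  - move: h2; rewrite invfM => h2; rewrite mulrC -ler_pdivlMr//.
  - by rewrite EP.
  - by rewrite /grid mul0r (fsde_init hsol) (scheme_init sch) subrr norm2_0.
  - by move=> m _; exact: norm2_ge0.
  - move=> m mP em.
    exact: (error_step hW hT htheta halpha hbeta hgamma hbeta_ad hgamma_ad hsol
      (ltW LA0) L0 K0 U_le hLA bl gl bb gb P0 sch C10 hC1 h1 mP em).
split.
  exists ((M + 1) ^+ 2); first by rewrite exprn_gt0.
  exists h0 => // P hP hh n nP.
  have [e1 e2] := main P hP hh n nP; have [sch _] := hUb P hP.
  have sUb := scheme_sa sch nP; have ht := grid_le hT (hPs P hP) nP.
  have sU := U_sa hsol ht.
  rewrite ler_pXn2r ?nnegrE ?norm2_ge0 ?(ltW M1)//.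
  apply: le_trans (norm2_le_dist sUb.1 sU.1) _; rewrite lerD ?U_le//.
  rewrite (norm2_sub sUb.1 sU.1).
  by rewrite -(@expr_le1 _ 2) ?norm2_ge0//; exact: le_trans e1 e2.
exists (Num.sqrt E); first by rewrite sqrtr_gt0.
exists h0 => // P hP hh n nP; have [e1 _] := main P hP hh n nP.
rewrite -sqrtrM ?(ltW E0)// -[leLHS]ger0_norm ?norm2_ge0// -sqrtr_sqr.
by rewrite ler_wsqrtr.
Qed.
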